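(* Let $S_t$ be the smooth del Pezzo surface of degree $1$ over the function field $\mathbb{C}(t)$ given by $$ S_t=\big\{y^2=x^3-3u^2v^2x-u^5v-uv^5-27t^2u^2v^4\big\}\subset\mathbb{P}_{\mathbb{C}(t)}(1_u,1_v,2_x,3_y). $$ Then there is a dominant rational map $\mathbb{P}^2_{\mathbb{C}(t)}\dashrightarrow S_t$ of degree $9$ defined over $\mathbb{C}(t)$.
   Context: $\mathbb{P}_{\mathbb{C}(t)}(1_u,1_v,2_x,3_y)$ denotes the weighted projective space over $\mathbb{C}(t)$ with homogeneous coordinates $u,v,x,y$ of weights $1,1,2,3$, respectively. A del Pezzo surface of degree $1$ over a field is a smooth projective geometrically integral surface $S$ with $-K_S$ ample and $(-K_S)^2=1$. *)

(* Defs.v *)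
(* Mathematical Components, with multinomials for polynomials in several
   variables and R[i], for R : realType, as the field of complex numbers. *)
From HB Require Import structures.
From mathcomp Require Import all_boot all_order all_algebra.
From mathcomp Require Import fraction.
From mathcomp Require Import reals complex mpoly.

Set Implicit Arguments.
Unset Strict Implicit.
Unset Printing Implicit Defensive.

Import GRing.Theory.
Local Open Scope ring_scope.

Section WeightedDegree.
Variables (n : nat) (w : n.-tuple nat).

Definition wdeg (m : 'X_{1..n}) : nat := (\sum_(i < n) tnth w i * m i)%N.

Lemma wdeg0 : wdeg 0%MM = 0%N.
Proof. by rewrite /wdeg big1 // => i _; rewrite mnm0E muln0. Qed.

Lemma wdegD : {morph wdeg : m1 m2 / (m1 + m2)%MM >-> (m1 + m2)%N}.
Proof.
move=> m1 m2; rewrite /wdeg -big_split /=.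
by apply: eq_bigr => i _; rewrite mnmDE mulnDr.
Qed.

HB.instance Definition _ := isMeasure.Build n wdeg wdeg0 wdegD.

End WeightedDegree.

(* The principal ideal generated by F. *)
Definition in_ideal (A : comNzRingType) (F G : A) : Prop :=
  exists Q : A, G = Q * F.

Section WeightedHypersurface.
Variables (K : fieldType) (n : nat) (w : n.-tuple nat) (F : {mpoly K[n]}).

(* The homogeneous coordinate ring of {F = 0} is an integral domain after every
   extension of the base field. *)
Definition geom_integral : Prop :=
  forall (L : fieldType) (iota : {rmorphism K -> L}),
    let FL := map_mpoly iota F in
    ~ in_ideal FL 1 /\
    forall G H : {mpoly L[n]},
      in_ideal FL (G * H) -> in_ideal FL G \/ in_ideal FL H.

(* Jacobian criterion.  At a point a of P(w), the weights of the nonzero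
   coordinates have gcd 1 exactly when G_m acts with trivial stabilizer at a;
   there the punctured affine cone of {F = 0} is a G_m-torsor over {F = 0}, so
   that {F = 0} is smooth at a if and only if its cone is.  The hypersurface is
   also required to avoid the points of P(w) with nontrivial stabilizer, which
   for w = (1,1,2,3) are the two singular points of P(w).  S_t avoids them, as
   its equation contains y^2 and x^3. *)
Definition smooth_whypersurface : Prop :=
  forall (L : fieldType) (iota : {rmorphism K -> L}) (a : 'I_n -> L),
    let FL := map_mpoly iota F in
    (exists i, a i != 0) -> FL.@[a] = 0 ->
    \big[gcdn/0%N]_(i < n | a i != 0) tnth w i = 1%N /\
    exists i, (FL^`M(i)).@[a] != 0.

End WeightedHypersurface.

(* Rational maps from P^m to the hypersurface {F = 0} of P(w), written in
   homogeneous coordinates: the i-th coordinate is a form of degree d * w_i.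
   If P(w) has a coordinate of weight 1 that does not vanish identically on
   the image, as is the case for a dominant map to S_t, then every
   rational map has this form: its value at the generic point has homogeneous
   coordinates in the function field of P^m, and rescaling by a form
   clears the denominators. *)
Record ratmap (K : fieldType) (m n : nat) (w : n.-tuple nat)
    (F : {mpoly K[n]}) := RatMap {
  rm_deg : nat;
  rm_coord : n.-tuple {mpoly K[m.+1]};
  rm_homog : forall i,
    tnth rm_coord i \is (rm_deg * tnth w i).-homog for (@mdeg m.+1);
  rm_neq0 : exists i, tnth rm_coord i != 0;
  rm_image : F \mPo rm_coord = 0 }.

(* The function field of P^m, as the degree-0 part of the field of fractions
   of its homogeneous coordinate ring. *)
Definition funfield_proj (K : fieldType) (m : nat)
    (h : {fraction {mpoly K[m.+1]}}) : Prop :=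
  exists (d : nat) (P Q : {mpoly K[m.+1]}),
    [/\ P \is d.-homog for (@mdeg m.+1), Q \is d.-homog for (@mdeg m.+1),
        Q != 0 & h = tofrac P / tofrac Q].

Section RationalMap.
Variables (K : fieldType) (m n : nat) (w : n.-tuple nat) (F : {mpoly K[n]}).
Variable f : @ratmap K m n w F.

(* The image is Zariski dense in {F = 0}, assumed integral: a form vanishing
   on the image vanishes on {F = 0}. *)
Definition dominant : Prop :=
  forall (e : nat) (G : {mpoly K[n]}),
    G \is e.-homog for (wdeg w) -> G \mPo rm_coord f = 0 -> in_ideal F G.

(* For f dominant, the image under f^* of the function field of {F = 0}, whose
   elements are the G / H with G, H of the same degree and H nonzero modulo F. *)
Definition funfield_pullback (h : {fraction {mpoly K[m.+1]}}) : Prop :=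
  exists (e : nat) (G H : {mpoly K[n]}),
    [/\ G \is e.-homog for (wdeg w), H \is e.-homog for (wdeg w),
        ~ in_ideal F H &
        h = tofrac (G \mPo rm_coord f) / tofrac (H \mPo rm_coord f)].

End RationalMap.

(* [l : k] = r, for subfields k and l of M with k contained in l. *)
Definition ext_degree (M : fieldType) (k l : M -> Prop) (r : nat) : Prop :=
  exists b : 'I_r -> M,
    [/\ forall i, l (b i),
        forall h, l h -> exists c : 'I_r -> M,
          (forall i, k (c i)) /\ h = \sum_(i < r) c i * b i &
        forall c : 'I_r -> M, (forall i, k (c i)) ->
          \sum_(i < r) c i * b i = 0 -> forall i, c i = 0].

Definition ratmap_degree (K : fieldType) (m n : nat) (w : n.-tuple nat)
    (F : {mpoly K[n]}) (f : @ratmap K m n w F) (r : nat) : Prop :=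
  ext_degree (funfield_pullback f) (@funfield_proj K m) r.

(* The field C(t). *)
Definition Ct (R : realType) : fieldType := {fraction {poly R[i]}}.

Definition Ct_var (R : realType) : Ct R := tofrac 'X.

Definition w1123 : 4.-tuple nat := [tuple 1; 1; 2; 3]%N.

(* A smooth sextic in P(1,1,2,3) is a del Pezzo surface of degree 1: by
   adjunction its canonical sheaf is O(6 - 7) = O(-1), and O(1) has
   self-intersection 6 / (1 * 1 * 2 * 3) = 1. *)
Definition S_t (R : realType) : {mpoly (Ct R)[4]} :=
  let u := 'X_(@Ordinal 4 0 isT) in
  let v := 'X_(@Ordinal 4 1 isT) in
  let x := 'X_(@Ordinal 4 2 isT) in
  let y := 'X_(@Ordinal 4 3 isT) in
  y ^+ 2 - (x ^+ 3 - 3%:R *: (u ^+ 2 * v ^+ 2 * x) - u ^+ 5 * v - u * v ^+ 5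
            - (27%:R * Ct_var R ^+ 2) *: (u ^+ 2 * v ^+ 4)).

(* Main.v *)
Require Import Defs.
From HB Require Import structures.
From mathcomp Require Import all_boot all_order all_algebra.
From mathcomp Require Import generic_quotient fraction reals complex mpoly ring zify.

(** The surface is the Jacobian of a pencil of plane cubics.  Put
    U = Z^3 - X^2 Y - 2 t X^3 and V = Y^3 - X^2 Z.  A general point of the plane
    lies on exactly one of the cubics
    u (X^2 Z - Y^3) + v (Z^3 - X^2 Y - 2 t X^3) = 0, the one with
    (u : v) = (U : V), and the Jacobian of that cubic is the fibre
    y^2 = x^3 - 3 u^2 v^2 x - (u^5 v + u v^5 + 27 t^2 u^2 v^4) of S_t over
    (u : v).  With H the class of a line section, sending a point P of the
    cubic to the class of 3 P - H defines a rational map from the plane to S_t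
    which on every smooth fibre is, over an algebraic closure, multiplication
    by 3 after a translation; hence its degree is 9.

    Its coordinates are explicit covariants of the cubic.  The point P goes to
    zero exactly when it is a flex, so that the denominator of x is the square
    of a form [flexform] cutting out the flexes; x is minus the second
    logarithmic derivative of [flexform] along the cubic, up to a correction at
    the line X = 0, and y is the derivative of x.  That the image lies on S_t is
    a polynomial identity, [triple_syzygy].

    The degree is computed as the dimension of the function field l of the plane
    over the function field k of S_t.  With p = Y/X and q = Z/X, the nine
    functions q^r (p q)^j, for r and j less than 3, form a basis.

    They are independent ([image_monomials_free]) because they stay so when t
    tends to infinity.  In suitable coordinates rho and q of the plane, with
    sigma = q^6 - q^3, the limit of the map is
    (rho^3 sigma : 1 : rho^2 (1 + sigma) : rho^3 (2 q^3 - 1)(sigma - 2) / 2),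
    where a relation can be split successively by the degree in rho, by the
    degree in q modulo 6 and by the order of vanishing at sigma = -1
    ([degenerate_monomials_free]).  Clearing denominators and dividing by powers
    of the parameter carries this over to C(t) ([specialize_free]).  Since all
    monomials of a given weight modulo the equation of S_t are treated at the
    same time, dominance is a special case ([kernel_ideal]).

    They span because the function x/v^2 has degree at most 18 on the cubic over
    C(t)(u/v): any 19 elements of l are dependent over C(t)(u/v, x/v^2), by a
    count of monomials of bounded degree ([bounded_degree]).  Applied to h, the
    nine functions, and the products of these ten by y/v^3, this gives a
    relation between h and the nine functions over k ([spanning_relation]), in
    which h occurs by independence of the nine.

    Integrality of S_t holds because its equation is y^2 - f with f of odd degree
    in x.  Smoothness is the Jacobian criterion: a singular point would force
    (19683 t^4)^2 = 256^2 or t = 0. *)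

Set Implicit Arguments.
Unset Strict Implicit.
Unset Printing Implicit Defensive.

Import GRing.Theory Num.Theory.
Local Open Scope ring_scope.

(** * Generalities on sums, polynomials and fractions *)

Lemma big_ord3 (A : Type) (idx : A) (op : A -> A -> A) (G : 'I_3 -> A) :
  \big[op/idx]_(i < 3) G i =
    op (G (@Ordinal 3 0 isT)) (op (G (@Ordinal 3 1 isT))
      (op (G (@Ordinal 3 2 isT)) idx)).
Proof.
rewrite !big_ord_recl big_ord0.
by do !congr (op (G _) _); apply: val_inj.
Qed.

Lemma big_ord4 (T : Type) (idx : T) (op : T -> T -> T) (F : 'I_4 -> T) :
  \big[op/idx]_(i < 4) F i =
    op (F (@Ordinal 4 0 isT)) (op (F (@Ordinal 4 1 isT))
      (op (F (@Ordinal 4 2 isT)) (op (F (@Ordinal 4 3 isT)) idx))).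
Proof.
rewrite !big_ord_recl big_ord0.
by do !congr (op (F _) _); apply: val_inj.
Qed.

Lemma dhomogM_eq (n : nat) (A : comNzRingType) (mf : measure n) d e k
    (p q : {mpoly A[n]}) :
  p \is d.-homog for mf -> q \is e.-homog for mf -> k = (d + e)%N ->
  p * q \is k.-homog for mf.
Proof. by move=> hp hq ->; exact: dhomogM. Qed.

Lemma dhomogXn_eq (n : nat) (A : comNzRingType) (mf : measure n) d e k
    (p : {mpoly A[n]}) :
  p \is d.-homog for mf -> e = (d * k)%N -> p ^+ k \is e.-homog for mf.
Proof. by move=> hp ->; exact: dhomogMn. Qed.

Lemma dhomogXU (n : nat) (A : comNzRingType) (mf : measure n) i d :
  mf U_(i)%MM = d -> ('X_i : {mpoly A[n]}) \is d.-homog for mf.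
Proof. by move=> <-; rewrite dhomogX. Qed.

Lemma wdegU n (w : n.-tuple nat) i : wdeg w U_(i)%MM = tnth w i.
Proof.
rewrite /wdeg (bigD1 i) //= mnm1E eqxx muln1 big1 ?addn0 // => j ji.
by rewrite mnm1E eq_sym (negPf ji) muln0.
Qed.

Lemma mpoly_X_neq0 (K : fieldType) n (i : 'I_n) : ('X_i : {mpoly K[n]}) != 0.
Proof. by rewrite -msupp_eq0 msuppX. Qed.

Section Fractions.
Variable A : idomainType.

Lemma frac_repr (x : {fraction A}) :
  x = tofrac (\n_(repr x)) / tofrac (\d_(repr x)).
Proof.
have d0 : tofrac (\d_(repr x)) != 0 :> {fraction A} by rewrite tofrac_eq0 denom_ratioP.
apply: (canRL (mulfK d0)); rewrite -{1}[x]reprK; move: (repr x) => {d0}y.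
unlock FracField.tofrac; rewrite -[LHS]FracField.pi_mul; apply/eqmodP.
rewrite /= FracField.equivfE /FracField.mulf !numden_Ratio ?mulf_neq0 ?oner_eq0 ?denom_ratioP //.
by rewrite !mulr1 mulrC.
Qed.

Lemma fracP (x : {fraction A}) : exists a b : A, b != 0 /\ x = tofrac a / tofrac b.
Proof.
exists (\n_(repr x)), (\d_(repr x)); split; last exact: frac_repr.
exact: denom_ratioP.
Qed.

Lemma common_denominator (I : finType) (x : I -> {fraction A}) :
  exists d, exists a : I -> A, d != 0 /\ forall i, x i * tofrac d = tofrac (a i).
Proof.
pose dn i := \d_(repr (x i)).
exists (\prod_i dn i), (fun i => \n_(repr (x i)) * \prod_(k | k != i) dn k).
split=> [|i]; first by apply/prodf_neq0 => i _; exact: denom_ratioP.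
rewrite {1}[x i]frac_repr (bigD1 i) //= !rmorphM /= mulrA divfK //.
by rewrite tofrac_eq0 denom_ratioP.
Qed.

Variables (F : fieldType) (phi : {rmorphism A -> F}).
Hypothesis phi_inj : injective phi.

Definition frac_lift (phi_inj : injective phi) (x : {fraction A}) : F :=
  phi (\n_(repr x)) / phi (\d_(repr x)).

Let phi0 a : a != 0 -> phi a != 0.
Proof. by apply: contraNneq => e; apply/eqP/phi_inj; rewrite e rmorph0. Qed.

Lemma frac_lift_div a b : b != 0 ->
  frac_lift phi_inj (tofrac a / tofrac b) = phi a / phi b.
Proof.
move=> b0; set x := _ / _; have := frac_repr x; rewrite /frac_lift.
have d0 : \d_(repr x) != 0 := denom_ratioP _.
move: (\n_(repr x)) (\d_(repr x)) d0 => n d d0 e.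
apply/eqP; rewrite eqr_div ?phi0 // -!rmorphM; apply/eqP; congr (phi _).
by apply/eqP; rewrite -tofrac_eq !rmorphM /= -eqr_div ?tofrac_eq0 // -e.
Qed.

Lemma frac_lift_tofrac a : frac_lift phi_inj (tofrac a) = phi a.
Proof. by rewrite -[tofrac a]divr1 -tofrac1 frac_lift_div ?oner_eq0 // rmorph1 divr1. Qed.

Lemma frac_lift_is_zmod_morphism : zmod_morphism (frac_lift phi_inj).
Proof.
move=> x y; have [a [b [b0 ->]]] := fracP x; have [c [d [d0 ->]]] := fracP y.
rewrite -mulNr -rmorphN addf_div ?tofrac_eq0 // -!rmorphM -rmorphD.
rewrite !frac_lift_div ?mulf_neq0 // !(rmorphD, rmorphM, rmorphN) /=.
by rewrite -mulNr addf_div ?phi0.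
Qed.

Lemma frac_lift_is_monoid_morphism : monoid_morphism (frac_lift phi_inj).
Proof.
split=> [|x y]; first by rewrite -tofrac1 frac_lift_tofrac rmorph1.
have [a [b [b0 ->]]] := fracP x; have [c [d [d0 ->]]] := fracP y.
rewrite mulf_div -!rmorphM !frac_lift_div ?mulf_neq0 // !rmorphM /=.
by rewrite mulf_div.
Qed.

HB.instance Definition _ := GRing.isZmodMorphism.Build {fraction A} F
  (frac_lift phi_inj) frac_lift_is_zmod_morphism.
HB.instance Definition _ := GRing.isMonoidMorphism.Build {fraction A} F
  (frac_lift phi_inj) frac_lift_is_monoid_morphism.
End Fractions.

(** If a relation with coefficients P i held, a common factor 'X could be
    divided out of the P i as long as all their constant terms vanish; and they
    do, by independence of the constant terms of the W i.  The degrees drop at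
    every division, so that all P i are 0. *)
Lemma specialize_free (C : nzRingType) (D : idomainType) (iota : {rmorphism C -> D})
    (I : finType) (W : I -> {poly D}) :
  (forall g : I -> C, \sum_i iota (g i) * (W i)`_0 = 0 -> forall i, g i = 0) ->
  forall P : I -> {poly C}, \sum_i map_poly iota (P i) * W i = 0 ->
  forall i, P i = 0.
Proof.
move=> free P; move: {2}(\max_i size (P i)) (leqnn (\max_i size (P i))) => n.
elim: n P => [|n ih] P szP s0 i.
  apply/eqP; rewrite -size_poly_leq0; apply: leq_trans szP.
  exact: (leq_bigmax i).
have P0 : forall k, (P k)`_0 = 0.
  apply: free; rewrite -[RHS](coef0 _ 0) -s0 coef_sum; apply: eq_bigr => k _.
  by rewrite coef0M coef_map.
have eP k : P k = drop_poly 1 (P k) * 'X.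
  by apply/polyP => -[|l]; rewrite coefMX /= ?P0 // coef_drop_poly addn1.
rewrite eP (ih (fun k => drop_poly 1 (P k))) ?mul0r {i}//.
  apply/bigmax_leqP => k _; rewrite size_drop_poly leq_subLR addnC addn1.
  by apply: leq_trans szP; exact: (leq_bigmax k).
have X0 : ('X : {poly D}) != 0 by rewrite -size_poly_eq0 size_polyX.
apply: (mulIf X0); rewrite [RHS]mul0r -[RHS]s0 big_distrl /=.
by apply: eq_bigr => k _; rewrite [in RHS]eP rmorphM /= map_polyX mulrAC.
Qed.

(** More vectors than a spanning family has elements: a nonzero vector of the
    left kernel of the matrix of coefficients is a relation.  L need not be
    finite over K, hence the explicit families. *)
Lemma linear_dependence (K : fieldType) (L : comNzRingType) (phi : {rmorphism K -> L})
    (I J : finType) (w : J -> L) (v : I -> L) :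
  (#|J| < #|I|)%N ->
  (forall i, exists c : J -> K, v i = \sum_j phi (c j) * w j) ->
  exists2 g : I -> K, exists i, g i != 0 & \sum_i phi (g i) * v i = 0.
Proof.
move=> JI /fin_all_exists[c vE].
pose M := \matrix_(i < #|I|, j < #|J|) c (enum_val i) (enum_val j).
have kM : kermx M != 0.
  rewrite -mxrank_eq0 mxrank_ker subn_eq0 -ltnNge.
  exact: leq_ltn_trans (rank_leq_col M) JI.
pose x := nz_row (kermx M).
have x0 : x != 0 by rewrite nz_row_eq0.
have xM : x *m M = 0 by apply/sub_kermxP; exact: nz_row_sub.
exists (fun i => x 0 (enum_rank i)).
  by have /rV0Pn[k xk] := x0; exists (enum_val k); rewrite enum_valK.
transitivity (\sum_j phi ((x *m M) 0 (enum_rank j)) * w j); last first.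
  by rewrite xM big1 // => j _; rewrite mxE rmorph0 mul0r.
under eq_bigr => i _ do rewrite vE big_distrr /=.
rewrite exchange_big /=; apply: eq_bigr => j _.
rewrite mxE rmorph_sum big_distrl /= [LHS](reindex_onto (@enum_val I I) (@enum_rank I)) /=.
  by apply: eq_big => [k|k _]; rewrite enum_valK ?eqxx // !mxE enum_rankK rmorphM mulrA.
by move=> i _; rewrite enum_rankK.
Qed.

Lemma clear_denominators (A : comNzRingType) (L : fieldType)
    (g : {rmorphism A -> L}) (J : finType) (G H : J -> A) k : g (H k) != 0 ->
  g (G k * \prod_(k' | k' != k) H k') =
    g (G k) / g (H k) * \prod_k' g (H k').
Proof.
by move=> H0; rewrite rmorphM rmorph_prod [in RHS](bigD1 k) //= mulrA divfK.
Qed.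

Lemma big_option (A : nmodType) (J : finType) (G : option J -> A) :
  \sum_o G o = G None + \sum_k G (Some k).
Proof.
rewrite (bigD1 None) //=; congr (_ + _).
rewrite (reindex_omap Some id) => [|[k|] //].
by apply: eq_bigl => k; rewrite eqxx.
Qed.

Lemma solve_relation (L : fieldType) (J : finType) (a h : L) (f b : J -> L) :
  a != 0 -> a * h + \sum_k f k * b k = 0 -> h = \sum_k - f k / a * b k.
Proof.
move=> a0 /eqP; rewrite addr_eq0 => /eqP e; apply: (mulfI a0).
rewrite e -sumrN big_distrr /=; apply: eq_bigr => k _.
by rewrite mulrA [a * _]mulrC divfK // mulNr.
Qed.

Lemma ext_degree_fin (M : fieldType) (k l : M -> Prop) (J : finType) (r : nat)
    (b : J -> M) : #|J| = r ->
  (forall j, l (b j)) ->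
  (forall h, l h -> exists c : J -> M,
     (forall j, k (c j)) /\ h = \sum_j c j * b j) ->
  (forall c : J -> M, (forall j, k (c j)) -> \sum_j c j * b j = 0 ->
     forall j, c j = 0) ->
  ext_degree k l r.
Proof.
move=> <- lb sp fr.
have sumJ (G : J -> M) : \sum_j G j = \sum_(i < #|J|) G (enum_val i).
  rewrite (reindex_onto (@enum_val J J) (@enum_rank J)) /=.
    by apply: eq_bigl => i; rewrite enum_valK eqxx.
  by move=> i _; rewrite enum_rankK.
exists (fun i => b (enum_val i)); split=> [i|h /sp[c [kc ->]]|c kc s0 i].
- exact: lb.
- by exists (fun i => c (enum_val i)); split=> [i|]; [exact: kc | rewrite sumJ].
rewrite -(enum_valK i); apply: (fr (fun j => c (enum_rank j))) => [j|]; first exact: kc.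
by rewrite sumJ -[RHS]s0; apply: eq_bigr => j _; rewrite enum_valK.
Qed.

(** * The sextic *)

Definition sextic (L : comNzRingType) (t : L) : {mpoly L[4]} :=
  let u := 'X_(@Ordinal 4 0 isT) in
  let v := 'X_(@Ordinal 4 1 isT) in
  let x := 'X_(@Ordinal 4 2 isT) in
  let y := 'X_(@Ordinal 4 3 isT) in
  y ^+ 2 - (x ^+ 3 - 3%:R *: (u ^+ 2 * v ^+ 2 * x) - u ^+ 5 * v - u * v ^+ 5
            - (27%:R * t ^+ 2) *: (u ^+ 2 * v ^+ 4)).

Lemma S_tE (R : realType) : S_t R = sextic (Ct_var R).
Proof. by []. Qed.

Lemma sextic_homog (L : comNzRingType) (t : L) :
  sextic t \is 6.-homog for (wdeg w1123).
Proof.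
have hu : 'X_(@Ordinal 4 0 isT) \is [in L[4], 1.-homog for (wdeg w1123)] by apply: dhomogXU; exact: (wdegU w1123).
have hv : 'X_(@Ordinal 4 1 isT) \is [in L[4], 1.-homog for (wdeg w1123)] by apply: dhomogXU; exact: (wdegU w1123).
have hx : 'X_(@Ordinal 4 2 isT) \is [in L[4], 2.-homog for (wdeg w1123)] by apply: dhomogXU; exact: (wdegU w1123).
have hy : 'X_(@Ordinal 4 3 isT) \is [in L[4], 3.-homog for (wdeg w1123)] by apply: dhomogXU; exact: (wdegU w1123).
rewrite /sextic.
by repeat first [ exact: hu | exact: hv | exact: hx | exact: hy
  | apply: rpredB | apply: dhomogZ
  | apply: dhomogXn_eq; [exact: hu| by []]
  | apply: dhomogXn_eq; [exact: hv| by []]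
  | apply: dhomogXn_eq; [exact: hx| by []]
  | apply: dhomogXn_eq; [exact: hy| by []]
  | eapply dhomogM_eq].
Qed.

(** The polynomial is also needed as a function on a ring, for values of the
    variables and for the images of the variables under ring morphisms. *)
Definition sextic_at (S : comNzRingType) (t u v x y : S) : S :=
  y ^+ 2 - (x ^+ 3 - 3%:R * (u ^+ 2 * v ^+ 2 * x) - u ^+ 5 * v - u * v ^+ 5
            - 27%:R * t ^+ 2 * (u ^+ 2 * v ^+ 4)).

Local Notation Xu := 'X_(@Ordinal 4 0 isT).
Local Notation Xv := 'X_(@Ordinal 4 1 isT).
Local Notation Xx := 'X_(@Ordinal 4 2 isT).
Local Notation Xy := 'X_(@Ordinal 4 3 isT).

Lemma sexticE (L : comNzRingType) (t : L) :
  sextic t = sextic_at t%:MP Xu Xv Xx Xy.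
Proof.
rewrite /sextic /sextic_at -!mul_mpolyC !(mpolyCM, rmorphXn) /=.
by rewrite !(rmorph_nat (@mpolyC 4 L)).
Qed.

Lemma rmorph_sextic_at (S S' : comNzRingType) (g : {rmorphism S -> S'})
    (t u v x y : S) :
  g (sextic_at t u v x y) = sextic_at (g t) (g u) (g v) (g x) (g y).
Proof.
by rewrite /sextic_at !(rmorphB g, rmorphM g, rmorphXn g, rmorph_nat g).
Qed.

Lemma map_sextic (L M : comNzRingType) (f : {rmorphism L -> M}) (t : L) :
  map_mpoly f (sextic t) = sextic (f t).
Proof.
rewrite !sexticE (rmorph_sextic_at (map_mpoly f)) /=.
by rewrite (map_mpolyC _ f) !map_mpolyX.
Qed.

Lemma meval_sextic (L : comNzRingType) (t : L) (a : 'I_4 -> L) :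
  (sextic t).@[a] = sextic_at t (a (@Ordinal 4 0 isT)) (a (@Ordinal 4 1 isT))
    (a (@Ordinal 4 2 isT)) (a (@Ordinal 4 3 isT)).
Proof.
by rewrite sexticE (rmorph_sextic_at (meval a)) /= !mevalXU mevalC.
Qed.

Section RationalFunctions.
Variable C : fieldType.
Hypothesis char0 : forall n, n.+1%:R != 0 :> C.
Notation K := {fraction {poly C}}.

Lemma rational_function_natr_neq0 n : n.+1%:R != 0 :> K.
Proof.
by rewrite -(rmorph_nat (@tofrac _)) tofrac_eq0 -polyC_natr polyC_eq0.
Qed.

(** Clearing the denominators compares coefficients of t^n: this shows that no
    value of t which is excluded by smoothness is attained by the variable. *)
Lemma variable_power_not_const n (a b : nat) : (0 < n)%N ->
  a.+1%:R * tofrac 'X ^+ n != b%:R :> K.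
Proof.
move=> n0; rewrite -!(rmorph_nat (@tofrac _)) -rmorphXn -rmorphM /=.
rewrite tofrac_eq; apply/eqP => /(congr1 (fun p : {poly _} => p`_n)).
rewrite -!polyC_natr coefCM coefXn eqxx mulr1 coefC gtn_eqF // => /eqP.
by rewrite (negPf (char0 _)).
Qed.
End RationalFunctions.

Lemma complex_natr_neq0 (R : realType) n : n.+1%:R != 0 :> R[i].
Proof. by rewrite pnatr_eq0. Qed.

(** * Smoothness *)

(** All the partial derivatives of the sextic at a point are obtained at once
    from a derivation over the evaluation morphism. *)
Section Derivation.
Variables (A L : comNzRingType) (g : {rmorphism A -> L}) (d : A -> L).
Hypothesis dB : forall p q, d (p - q) = d p - d q.
Hypothesis dM : forall p q, d (p * q) = d p * g q + g p * d q.

Let d1 : d 1 = 0.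
Proof.
apply: (@addrI _ (d 1)); rewrite addr0.
by rewrite -[in RHS](mulr1 1) dM rmorph1 mulr1 mul1r.
Qed.
Let d0 : d 0 = 0. Proof. by rewrite -(subrr 0) dB subrr. Qed.
Let dn n : d n%:R = 0.
Proof.
elim: n => [|n ih]; first exact: d0.
by rewrite -addn1 natrD -[1%:R]opprK dB ih -(sub0r 1) dB d0 d1 !subr0.
Qed.
Let dXn p k : d (p ^+ k.+1) = k.+1%:R * g p ^+ k * d p.
Proof.
elim: k => [|k ih]; first by rewrite expr1 expr0 !mul1r.
by rewrite exprS dM ih (rmorphXn g) -[k.+2]addn1 natrD exprS; ring.
Qed.

Lemma derivation_sextic (t u v x y : A) : d t = 0 ->
  d (sextic_at t u v x y) =
    (6%:R * g u * g v ^+ 2 * g x + 5%:R * g u ^+ 4 * g v + g v ^+ 5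
      + 54%:R * g t ^+ 2 * g u * g v ^+ 4) * d u
    + (6%:R * g u ^+ 2 * g v * g x + g u ^+ 5 + 5%:R * g u * g v ^+ 4
      + 108%:R * g t ^+ 2 * g u ^+ 2 * g v ^+ 3) * d v
    + (3%:R * g u ^+ 2 * g v ^+ 2 - 3%:R * g x ^+ 2) * d x
    + 2%:R * g y * d y.
Proof.
move=> dt; rewrite /sextic_at !(dB, dM, dXn, dn) dt.
by rewrite !(rmorphM g, rmorphXn g, rmorph_nat g); ring.
Qed.
End Derivation.

Lemma meval_dsextic (L : comNzRingType) (t : L) (a : 'I_4 -> L) :
  let u := a (@Ordinal 4 0 isT) in
  let v := a (@Ordinal 4 1 isT) in
  let x := a (@Ordinal 4 2 isT) in
  let y := a (@Ordinal 4 3 isT) in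
  [/\ ((sextic t)^`M(@Ordinal 4 0 isT)).@[a] =
        6%:R * u * v ^+ 2 * x + 5%:R * u ^+ 4 * v + v ^+ 5
        + 54%:R * t ^+ 2 * u * v ^+ 4,
      ((sextic t)^`M(@Ordinal 4 1 isT)).@[a] =
        6%:R * u ^+ 2 * v * x + u ^+ 5 + 5%:R * u * v ^+ 4
        + 108%:R * t ^+ 2 * u ^+ 2 * v ^+ 3,
      ((sextic t)^`M(@Ordinal 4 2 isT)).@[a] =
        3%:R * u ^+ 2 * v ^+ 2 - 3%:R * x ^+ 2 &
      ((sextic t)^`M(@Ordinal 4 3 isT)).@[a] = 2%:R * y].
Proof.
move=> u v x y.
pose d i (p : {mpoly L[4]}) := (p^`M(i)).@[a].
have dB i p q : d i (p - q) = d i p - d i q by rewrite /d mderivB mevalB.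
have dM i p q : d i (p * q) = d i p * q.@[a] + p.@[a] * d i q.
  by rewrite /d mderivM mevalD !mevalM.
have dC i : d i t%:MP = 0 by rewrite /d mderivC meval0.
have D i := @derivation_sextic _ _ (meval a) _ (dB i) (dM i) _ Xu Xv Xx Xy (dC i).
have dX i j : ('X_j^`M(i)).@[a] = (j == i)%:R :> L.
  rewrite mderivX mevalZ mnm1E; case: eqP => [->|]; last by rewrite mul0r.
  rewrite (_ : (U_(i) - U_(i))%MM = 0%MM) ?mpolyX0 ?meval1 ?mul1r //.
  by apply/mnmP => k; rewrite mnmBE subnn mnmE.
by split; rewrite sexticE [LHS]D /= /d !dX !mevalXU mevalC /= ?(mulr0, mulr1, addr0, add0r).
Qed.

Section Smooth.
Variables (L : fieldType) (t : L).
Hypothesis char0 : forall n, n.+1%:R != 0 :> L.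
Hypothesis t0 : t != 0.
Hypothesis t8 : (19683%:R * t ^+ 4) ^+ 2 != 256%:R ^+ 2.

(** At a singular point with y = 0 and uv nonzero, vanishing of the derivative
    in x gives x = e uv with e^2 = 1.  In s = u/v, the equation and the
    derivative in u combine to (3 s^2 - e)(s^2 + e) = 0: the first factor
    forces (19683 t^4)^2 = 256^2, the second t^2 s = 0. *)
Lemma singular_chart (u v x : L) : v != 0 -> u != 0 ->
  x ^+ 2 = u ^+ 2 * v ^+ 2 ->
  6%:R * u * v ^+ 2 * x + 5%:R * u ^+ 4 * v + v ^+ 5
    + 54%:R * t ^+ 2 * u * v ^+ 4 = 0 ->
  x ^+ 3 - 3%:R * (u ^+ 2 * v ^+ 2 * x) - u ^+ 5 * v - u * v ^+ 5
            - 27%:R * t ^+ 2 * (u ^+ 2 * v ^+ 4) = 0 -> False.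
Proof.
move=> v0 u0 x2 du f0.
have [e ex e2] : exists2 e, x = e * (u * v) & e ^+ 2 = 1.
  exists (x / (u * v)); first by rewrite divfK // mulf_neq0.
  by rewrite expr_div_n x2 exprMn divff // mulf_neq0 ?expf_neq0.
have [s us] : exists s, u = s * v by exists (u / v); rewrite divfK.
have s0 : s != 0 by apply: contraNneq u0 => z; rewrite us z mul0r.
have g1 : s ^+ 4 + 2%:R * e * s ^+ 2 + 1 + 27%:R * t ^+ 2 * s = 0.
  apply: (mulfI (mulf_neq0 s0 (expf_neq0 6 v0))); rewrite mulr0 -oppr0 -f0 ex us.
  have -> : (e * (s * v * v)) ^+ 3 = e * (e ^+ 2) * (s * v * v) ^+ 3 by ring.
  by rewrite e2; ring.
have g2 : 5%:R * s ^+ 4 + 6%:R * e * s ^+ 2 + 1 + 54%:R * t ^+ 2 * s = 0.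
  apply: (mulfI (expf_neq0 5 v0)); rewrite mulr0 -du ex us; ring.
(* the combination g2 - 2 g1 eliminates t; 1 is then replaced by e^2 *)
have g3 : (3%:R * s ^+ 2 - e) * (s ^+ 2 + e) = 0.
  transitivity (5%:R * s ^+ 4 + 6%:R * e * s ^+ 2 + 1 + 54%:R * t ^+ 2 * s
    - 2%:R * (s ^+ 4 + 2%:R * e * s ^+ 2 + 1 + 27%:R * t ^+ 2 * s) + (1 - e ^+ 2)).
    ring.
  by rewrite g1 g2 e2; ring.
move/eqP: g3; rewrite mulf_eq0 subr_eq0 addr_eq0 => /orP [] /eqP s2.
  have : 27%:R * t ^+ 2 * s * 9%:R = - 16%:R.
    have s4 : 9%:R * s ^+ 4 = 1 by rewrite -[RHS]e2 -s2; ring.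
    have es : 3%:R * e * s ^+ 2 = 1 by rewrite -[RHS]e2 -s2; ring.
    have := congr1 (fun z => 9%:R * z) g1; rewrite mulr0 => h.
    apply/eqP; rewrite -subr_eq0 -h; apply/eqP.
    transitivity (27%:R * t ^+ 2 * s * 9%:R + 9%:R * s ^+ 4
      + 6%:R * (3%:R * e * s ^+ 2) + 9%:R); last by ring.
    by rewrite s4 es; ring.
  move/(congr1 (fun z => z ^+ 2)) => h.
  have : 3%:R * (27%:R * t ^+ 2 * s * 9%:R) ^+ 2 =
         19683%:R * 3%:R * t ^+ 4 * (3%:R * s ^+ 2) by ring.
  rewrite h s2 => h2.
  apply: (negP t8); apply/eqP; apply: (mulfI (char0 8)).
  transitivity ((19683%:R * 3%:R * t ^+ 4 * e) ^+ 2); last by rewrite -h2; ring.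
  rewrite [RHS]exprMn e2; ring.
have : 27%:R * t ^+ 2 * s = 0.
  rewrite -g1 (_ : s ^+ 4 = (s ^+ 2) ^+ 2); last by rewrite -exprM.
  rewrite s2 (_ : (- e) ^+ 2 = 1); last by rewrite sqrrN.
  by transitivity (27%:R * t ^+ 2 * s + 2%:R * (1 - e ^+ 2)); [rewrite e2|]; ring.
by apply/eqP; rewrite !mulf_neq0 ?expf_neq0.
Qed.

End Smooth.

(** The weights: if u = v = 0 then y^2 = x^3 with x and y both nonzero, and
    gcd(2,3) = 1.  Smoothness: a singular point has y = 0 and x^2 = (uv)^2, and
    if u or v vanishes, the derivatives in v and u make the other one vanish. *)
Lemma sextic_smooth (L : fieldType) (t : L) :
  (forall n, n.+1%:R != 0 :> L) -> t != 0 ->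
  (19683%:R * t ^+ 4) ^+ 2 != 256%:R ^+ 2 ->
  forall a : 'I_4 -> L, (exists i, a i != 0) -> (sextic t).@[a] = 0 ->
  \big[gcdn/0%N]_(i < 4 | a i != 0) tnth w1123 i = 1%N /\
    exists i, ((sextic t)^`M(i)).@[a] != 0.
Proof.
move=> char0 t0 t8 a [i0 ai0]; rewrite meval_sextic.
have [] := meval_dsextic t a.
set u := a _; set v := a _; set x := a _; set y := a _ => du dv dx dy f0.
have xz : u = 0 -> v = 0 -> x = 0 -> y = 0 -> False.
  move=> hu hv hx hy; case/negP: ai0; apply/eqP.
  case: i0 => -[|[|[|[|//]]]] lt /=;
    [rewrite -[RHS]hu|rewrite -[RHS]hv|rewrite -[RHS]hx|rewrite -[RHS]hy];
    by congr a; apply: val_inj.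
split.
  rewrite big_mkcond big_ord4 /=.
  rewrite -/u -/v -/x -/y.
  have [hu|] := eqVneq u 0; last by rewrite gcd1n.
  have [hv|] := eqVneq v 0; last by rewrite gcd1n gcdn1.
  have hx : (x == 0) = (y == 0).
    move: f0; rewrite hu hv /sextic_at !(expr0n, mul0r, mulr0, subr0) /= => f0.
    rewrite -[LHS](expf_eq0 x 3) -[RHS](expf_eq0 y 2).
    by rewrite -(subr0 (y ^+ 2)) -{2}f0 opprB addrCA subrr addr0.
  have := xz hu hv; rewrite hx; have [hy|//] := eqVneq y 0.
  by move/eqP: hy; rewrite -hx => /eqP hx' /(_ hx'); move/eqP: hx'; rewrite hx => /eqP hy /(_ hy).
have [y0|y0] := eqVneq y 0; last first.
  by exists (@Ordinal 4 3 isT); rewrite dy mulf_neq0 ?char0.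
have [x2|x2] := eqVneq (3%:R * u ^+ 2 * v ^+ 2 - 3%:R * x ^+ 2) 0; last first.
  by exists (@Ordinal 4 2 isT); rewrite dx.
set Du := (X in _ = X) in du; set Dv := (X in _ = X) in dv.
have [du0|du0] := eqVneq Du 0; last by exists (@Ordinal 4 0 isT); rewrite du.
have [dv0|dv0] := eqVneq Dv 0; last by exists (@Ordinal 4 1 isT); rewrite dv.
have {}x2 : x ^+ 2 = u ^+ 2 * v ^+ 2.
  by apply: (mulfI (char0 2)); apply/eqP; rewrite eq_sym mulrA -subr_eq0 x2.
have x0 : u * v = 0 -> x = 0.
  by move/eqP => uv; apply/eqP; rewrite -[_ == 0](expf_eq0 x 2) x2 -exprMn expf_eq0.
have [v0|v0] := eqVneq v 0.
  case: (xz) => //; last by rewrite x0 // v0 mulr0.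
  apply/eqP; rewrite -[_ == 0](expf_eq0 u 5) -dv0 /Dv v0; apply/eqP; ring.
have [u0|u0] := eqVneq u 0.
  case/negP: v0; rewrite -[_ == 0](expf_eq0 v 5) -du0 /Du u0; apply/eqP; ring.
case: (singular_chart char0 t0 t8 v0 u0 x2 du0).
by rewrite -[RHS]oppr0 -[in RHS]f0 /sextic_at y0; ring.
Qed.

Lemma S_t_smooth (R : realType) : smooth_whypersurface w1123 (S_t R).
Proof.
move=> L iota a FL a0; rewrite /FL S_tE map_sextic => Fa.
have ch0 n : n.+1%:R != 0 :> L.
  by rewrite -(rmorph_nat iota) fmorph_eq0 (rational_function_natr_neq0 (@complex_natr_neq0 R)).
apply: sextic_smooth => //.
  rewrite fmorph_eq0.
  have := variable_power_not_const (@complex_natr_neq0 R) 0 0 (isT : (0 < 1)%N).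
  by rewrite mul1r expr1.
have -> : (19683%:R * iota (Ct_var R) ^+ 4) ^+ 2 =
          iota ((19683 ^ 2)%N%:R * Ct_var R ^+ 8).
  by rewrite (rmorphM iota) (rmorphXn iota) (rmorph_nat iota) natrX exprMn -[in LHS](exprM _ 4 2).
have -> : 256%:R ^+ 2 = iota (256 ^ 2)%N%:R by rewrite (rmorph_nat iota) natrX.
have c0 : (0 < 19683 ^ 2)%N by rewrite expn_gt0.
rewrite (inj_eq (fmorph_inj iota)) -(prednK c0).
exact: (variable_power_not_const (@complex_natr_neq0 R) _ _ (isT : (0 < 8)%N)).
Qed.

(** * Geometric integrality *)

(** A polynomial in n+1 variables is a polynomial in the last variable over
    the polynomials in the others.  The sextic becomes y^2 - f in this way,
    and f becomes a cubic polynomial in x. *)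
Section LastVariable.
Variables (n : nat) (A : comNzRingType).

Definition unmuni (p : {poly {mpoly A[n]}}) : {mpoly A[n.+1]} :=
  horner_eval 'X_ord_max (map_poly (@mwiden n A) p).

Lemma unmuniM : {morph unmuni : p q / p * q}.
Proof. by move=> p q; rewrite /unmuni !rmorphM. Qed.

Lemma muniK : cancel (@muni n A) unmuni.
Proof.
move=> p; rewrite muniE /unmuni rmorph_sum linear_sum [RHS]mpolyE /=.
apply: eq_bigr => m _; rewrite -mul_polyC rmorphM /= map_polyC map_polyXn.
rewrite /horner_eval hornerM hornerC hornerXn /= mwidenZ mwidenX -scalerAl.
congr (_ *: _); rewrite mpolyXn -mpolyXD; congr 'X_[_]; apply/mnmP => i.
rewrite mnmDE mulmnE mnm1E.
case: (unliftP ord_max i) => [j ->|->]; last first.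
  by rewrite eqxx mul1n mnmwiden_ordmax.
rewrite (negPf (neq_lift _ _)) mul0n addn0.
have -> : lift ord_max j = widen_ord (leqnSn n) j by apply: val_inj; rewrite /= /bump leqNgt ltn_ord.
by rewrite mnmwiden_widen mnmE.
Qed.

Lemma muniXmax : muni ('X_ord_max : {mpoly A[n.+1]}) = 'X.
Proof.
rewrite muniE msuppX big_seq1 mcoeffX eqxx scale1r mnm1E eqxx expr1.
rewrite (_ : [multinom _ | i < n] = 0%MM) ?mpolyX0 ?scale1r //.
apply/mnmP => i; rewrite !mnmE; case: eqP => // /(congr1 val) /= e.
by have := ltn_ord i; rewrite -e ltnn.
Qed.

Lemma muniXwiden j : muni ('X_(widen_ord (leqnSn n) j) : {mpoly A[n.+1]}) = ('X_j)%:P.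
Proof.
rewrite muniE msuppX big_seq1 mcoeffX eqxx scale1r mnm1E.
have -> : (widen_ord (leqnSn n) j == ord_max) = false.
  by apply/eqP => /(congr1 val) /= e; have := ltn_ord j; rewrite e ltnn.
rewrite expr0 alg_polyC; congr (_%:P); congr 'X_[_].
by apply/mnmP => i; rewrite !mnmE.
Qed.
End LastVariable.

(** A[y]/(y^2 - f) is a domain when f is not a square in the fractions of A:
    an element a + by that divides zero has norm a^2 - b^2 f = 0. *)
Section DoubleCover.
Variable (A : idomainType) (f : A).
Let F : {poly A} := 'X^2 - f%:P.
Hypothesis nosquare : forall P Q : A, P ^+ 2 = Q ^+ 2 * f -> Q = 0.

Let sF : size F = 3.
Proof. by rewrite size_polyDl size_polyXn // size_polyN size_polyC; case: eqP. Qed.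
Let mF : F \is monic.
Proof. by rewrite monicE lead_coefDl ?lead_coefXn // size_polyXn size_polyN size_polyC; case: eqP. Qed.

Lemma double_cover_small (r : {poly A}) : (size r < 3)%N -> in_ideal F r -> r = 0.
Proof.
move=> sr [Q e]; have := Pdiv.RingMonic.rmodp_mull mF Q.
by rewrite -e Pdiv.Ring.rmodp_small // sF.
Qed.

Lemma double_cover_integral :
  ~ in_ideal F 1 /\
  forall G H, in_ideal F (G * H) -> in_ideal F G \/ in_ideal F H.
Proof.
split=> [/double_cover_small|G H].
  by rewrite size_poly1 => /(_ isT) /eqP; rewrite oner_eq0.
have red (g : {poly A}) : exists Q a b, g = Q * F + (a%:P + b%:P * 'X).
  exists (Pdiv.Ring.rdivp g F); set r := Pdiv.Ring.rmodp g F.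
  exists r`_0, r`_1; rewrite {1}(Pdiv.RingMonic.rdivp_eq mF g) -/r.
  have sr : (size r < 3)%N.
    by move: (Pdiv.Ring.ltn_rmodpN0 g (monic_neq0 mF)); rewrite sF.
  congr (_ + _); apply/polyP => i; rewrite coefD coefC coefCM coefX.
  case: i => [|[|i]] /=; rewrite ?(mulr0, mulr1, addr0, add0r) //.
  by rewrite nth_default // -ltnS (leq_trans sr).
have [Q1 [a1 [b1 ->]]] := red G; have [Q2 [a2 [b2 ->]]] := red H.
move=> [Q e].
have z : (a1 * a2 + b1 * b2 * f)%:P + (a1 * b2 + b1 * a2)%:P * 'X = 0.
  apply: double_cover_small.
    rewrite (leq_ltn_trans (size_polyD _ _)) // gtn_max size_polyC.
    rewrite (leq_ltn_trans (leq_b1 _)) //= (leq_ltn_trans (size_polyMleq _ _)) //.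
    by rewrite size_polyX size_polyC addn2 /= ltnS ltnS leq_b1.
  exists (Q - Q1 * Q2 * F - Q1 * (a2%:P + b2%:P * 'X) - Q2 * (a1%:P + b1%:P * 'X) - (b1 * b2)%:P).
  have eF : 'X^2 = F + f%:P by rewrite /F subrK.
  transitivity (Q * F - Q1 * Q2 * F * F - Q1 * (a2%:P + b2%:P * 'X) * F - Q2 * (a1%:P + b1%:P * 'X) * F - (b1 * b2)%:P * F); last by ring.
  rewrite -e !(polyCD, polyCM) /F; ring.
have [e0 e1] : a1 * a2 + b1 * b2 * f = 0 /\ a1 * b2 + b1 * a2 = 0.
  have := congr1 (fun p : {poly A} => p`_0) z; have := congr1 (fun p : {poly A} => p`_1) z.
  by rewrite !(coefD, coefC, coefCM, coefX) /= !(mulr0, mulr1, addr0, add0r).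
have in0 Q' : in_ideal F (Q' * F + (0%:P + 0%:P * 'X)).
  by exists Q'; rewrite !polyC0 mul0r !addr0.
have k1 : a1 * (a2 ^+ 2 - b2 ^+ 2 * f) = 0.
  transitivity (a2 * (a1 * a2 + b1 * b2 * f) - b2 * f * (a1 * b2 + b1 * a2)); first by ring.
  by rewrite e0 e1; ring.
have k2 : b1 * (a2 ^+ 2 - b2 ^+ 2 * f) = 0.
  transitivity (a2 * (a1 * b2 + b1 * a2) - b2 * (a1 * a2 + b1 * b2 * f)); first by ring.
  by rewrite e0 e1; ring.
move/eqP: k1; rewrite mulf_eq0; case: eqP => [a10 _|_ /=].
  move/eqP: k2; rewrite mulf_eq0; case: eqP => [b10 _|_ /=].
    by left; rewrite a10 b10.
all: rewrite subr_eq0 => /eqP k; right; have b20 := nosquare k.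
all: move/eqP: k; rewrite b20 expr0n mul0r expf_eq0 /= => /eqP ->; exact: in0.
Qed.
End DoubleCover.

(** Parity of the degree in x. *)
Lemma cubic_nosquare (A : idomainType) (b c : A) (P Q : {poly A}) :
  P ^+ 2 = Q ^+ 2 * ('X^3 + b%:P * 'X + c%:P) -> Q = 0.
Proof.
set f := 'X^3 + _ + _ => e; apply/eqP; apply: contraT => Q0.
have sf : size f = 4.
  rewrite /f -addrA size_polyDl size_polyXn // ltnS (leq_trans (size_polyD _ _)) // geq_max.
  rewrite (leq_trans (size_polyC_leq1 _)) // andbT.
  have [->|b0] := eqVneq b 0; first by rewrite polyC0 mul0r size_poly0.
  by rewrite size_Cmul // size_polyX.
have f0 : f != 0 by rewrite -size_poly_gt0 sf.
have P0 : P != 0 by rewrite -[_ == 0](expf_eq0 P 2) e mulf_eq0 expf_eq0 /= negb_or Q0.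
have := congr1 (fun p : {poly A} => odd (size p)) e.
rewrite size_mul ?expf_neq0 // !expr2 !size_mul // sf.
move: P0 Q0; rewrite -!size_poly_gt0; case: (size P) => // i; case: (size Q) => // j _ _.
by rewrite !(addnS, addSn, addn0) /= !addnn !odd_double.
Qed.

Lemma sextic_at_square (A : comNzRingType) (t u v x y : A) :
  sextic_at t u v x y = y ^+ 2 - (- sextic_at t u v x 0).
Proof. by rewrite /sextic_at; ring. Qed.

Lemma sextic_at_cubic (A : comNzRingType) (t u v : A) :
  - sextic_at t%:P u%:P v%:P 'X 0 =
    'X^3 + (- (3%:R * (u ^+ 2 * v ^+ 2)))%:P * 'X
      + (- (u ^+ 5 * v + u * v ^+ 5 + 27%:R * t ^+ 2 * (u ^+ 2 * v ^+ 4)))%:P.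
Proof.
by rewrite /sextic_at !(polyCN, polyCD, polyCM, polyC_exp, polyC_natr); ring.
Qed.

Lemma sextic_integral (L : fieldType) (t : L) :
  let F := sextic t in
  ~ in_ideal F 1 /\
  forall G H, in_ideal F (G * H) -> in_ideal F G \/ in_ideal F H.
Proof.
have wu : 'X_(@Ordinal 4 0 isT) = 'X_(widen_ord (leqnSn 3) (@Ordinal 3 0 isT)) :> {mpoly L[4]} by congr 'X__; apply: val_inj.
have wv : 'X_(@Ordinal 4 1 isT) = 'X_(widen_ord (leqnSn 3) (@Ordinal 3 1 isT)) :> {mpoly L[4]} by congr 'X__; apply: val_inj.
have wx : 'X_(@Ordinal 4 2 isT) = 'X_(widen_ord (leqnSn 3) (@Ordinal 3 2 isT)) :> {mpoly L[4]} by congr 'X__; apply: val_inj.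
have wy : 'X_(@Ordinal 4 3 isT) = 'X_ord_max :> {mpoly L[4]} by congr 'X__; apply: val_inj.
have zu : 'X_(@Ordinal 3 0 isT) = 'X_(widen_ord (leqnSn 2) (@Ordinal 2 0 isT)) :> {mpoly L[3]} by congr 'X__; apply: val_inj.
have zv : 'X_(@Ordinal 3 1 isT) = 'X_(widen_ord (leqnSn 2) (@Ordinal 2 1 isT)) :> {mpoly L[3]} by congr 'X__; apply: val_inj.
have zx : 'X_(@Ordinal 3 2 isT) = 'X_ord_max :> {mpoly L[3]} by congr 'X__; apply: val_inj.
pose u3 : {mpoly L[3]} := 'X_(@Ordinal 3 0 isT).
pose v3 : {mpoly L[3]} := 'X_(@Ordinal 3 1 isT).
pose x3 : {mpoly L[3]} := 'X_(@Ordinal 3 2 isT).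
pose f3 := - sextic_at t%:MP u3 v3 x3 0.
have mF : muni (sextic t) = 'X^2 - f3%:P.
  rewrite sexticE [LHS](rmorph_sextic_at (@muni 3 L)) /=.
  rewrite wu wv wx wy !muniXwiden muniXmax muniC.
  rewrite sextic_at_square; congr (_ - _); rewrite /f3 polyCN; congr (- _).
  by rewrite [RHS](rmorph_sextic_at (@polyC _)).
have nosq (P Q : {mpoly L[3]}) : P ^+ 2 = Q ^+ 2 * f3 -> Q = 0.
  have ef : muni f3 = - sextic_at (t%:MP)%:P ('X_(@Ordinal 2 0 isT))%:P
      ('X_(@Ordinal 2 1 isT))%:P 'X 0.
    rewrite /f3 muniN; congr (- _); rewrite [LHS](rmorph_sextic_at (@muni 2 L)) /=.
    by rewrite /u3 /v3 /x3 zu zv zx !muniXwiden muniXmax muniC muni0.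
  move=> /(congr1 (@muni 2 L)).
  rewrite [LHS](rmorphXn (@muni 2 L)) [RHS]muniM [X in _ = X * _](rmorphXn (@muni 2 L)) /=.
  rewrite ef sextic_at_cubic => /cubic_nosquare e.
  by apply: (can_inj (@muniK 2 L)); rewrite muni0.
have tr G : in_ideal (sextic t) G <-> in_ideal ('X^2 - f3%:P) (muni G).
  split=> [[Q ->]|[Q e]]; first by exists (muni Q); rewrite muniM mF.
  by exists (unmuni Q); rewrite -[LHS]muniK e -mF unmuniM muniK.
have [i1 i2] := double_cover_integral nosq.
split=> [|G H]; first by rewrite tr muni1.
by rewrite !tr muniM; exact: i2.
Qed.

Lemma S_t_geom_integral (R : realType) : geom_integral (S_t R).
Proof. by move=> L iota; rewrite S_tE map_sextic; exact: sextic_integral. Qed.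

(** * The covariants of the cubic *)

(** The cubic is T = u (X^2 Z - Y^3) + v (Z^3 - X^2 Y - 2 t X^3), with partial
    derivatives [cubicZ] in Z and minus [cubicY] in Y, neither of which
    involves t.  The derivation D with D X = 0, D Y = [cubicZ], D Z = [cubicY]
    kills T, and is dual to the invariant differential of the cubic.

    Modulo T, [flexform] is a multiple of X^2 times the Hessian of T, so that
    it cuts out the flexes; it is written without t.  Its successive
    derivatives are D h = [flexder], D^2 h = 18 uv [flexder2] and
    D^3 h = 108 uv [flexder3], where h is [flexform].

    [triplex] / h^2 is minus the second logarithmic derivative of h plus
    27 uv YZ; the last term cancels the poles of the former on the line X = 0.
    What remains has only a double pole at every flex, with equal leading
    coefficients: it is the function P |-> x(3 P - H) up to scaling.
    [tripley] / h^3 is its derivative D ([triplex] / h^2). *)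
Section Covariants.
Variables (R : comNzRingType) (u v X Y Z : R).
Definition cubicZ := u * X ^+ 2 + 3%:R * v * Z ^+ 2.
Definition cubicY := v * X ^+ 2 + 3%:R * u * Y ^+ 2.
Definition flexform := v * Z * cubicY ^+ 2 - u * Y * cubicZ ^+ 2.
Definition flexder := v * cubicY ^+ 3 - u * cubicZ ^+ 3.
Definition flexder2 := cubicZ * cubicY * (Y * cubicY - Z * cubicZ).
Definition flexder3 :=
  (v * Z * cubicY ^+ 2 + u * Y * cubicZ ^+ 2) * (Y * cubicY - Z * cubicZ)
  + cubicZ * cubicY * (u * Y ^+ 2 * cubicZ - v * Z ^+ 2 * cubicY).
Definition triplex :=
  flexder ^+ 2 - 18%:R * u * v * flexder2 * flexform
  + 27%:R * u * v * Y * Z * flexform ^+ 2.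
Definition tripley :=
  54%:R * u * v * flexder2 * flexder * flexform - 2%:R * flexder ^+ 3
  - 108%:R * u * v * flexder3 * flexform ^+ 2
  + 27%:R * u * v * (cubicZ * Z + cubicY * Y) * flexform ^+ 3.

(** The Weierstrass equation satisfied by x(3 P - H) and y(3 P - H).  Here T is
    the cubic without its term in t; it equals 2 t v X^3 on the cubic, which
    is how 27 t^2 u^2 v^4 arises. *)
Lemma triple_syzygy :
  let T := u * (X ^+ 2 * Z - Y ^+ 3) + v * (Z ^+ 3 - X ^+ 2 * Y) in
  tripley ^+ 2 =
    4%:R * triplex ^+ 3 - 972%:R * u ^+ 2 * v ^+ 2 * X ^+ 4 * flexform ^+ 4 * triplex
    - 2916%:R * X ^+ 6 * flexform ^+ 6 * (u ^+ 5 * v + u * v ^+ 5)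
    - 27%:R * 729%:R * flexform ^+ 6 * u ^+ 2 * v ^+ 2 * T ^+ 2.
Proof.
move=> T; rewrite /T /tripley /triplex /flexder3 /flexder2 /flexder /flexform /cubicZ /cubicY.
ring.
Qed.
End Covariants.

Section Morph.
Variables (R S : comNzRingType) (f : {rmorphism R -> S}) (u v X Y Z : R).

Let fE := (rmorphB f, rmorphD f, rmorphM f, rmorphXn f, rmorph_nat f).

Let fA : f (cubicZ u v X Z) = cubicZ (f u) (f v) (f X) (f Z).
Proof. by rewrite /cubicZ !fE. Qed.
Let fB : f (cubicY u v X Y) = cubicY (f u) (f v) (f X) (f Y).
Proof. by rewrite /cubicY !fE. Qed.
Lemma rmorph_flexform :
  f (flexform u v X Y Z) = flexform (f u) (f v) (f X) (f Y) (f Z).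
Proof. by rewrite /flexform !(fE, fA, fB). Qed.
Let fder : f (flexder u v X Y Z) = flexder (f u) (f v) (f X) (f Y) (f Z).
Proof. by rewrite /flexder !(fE, fA, fB). Qed.
Let fder2 : f (flexder2 u v X Y Z) = flexder2 (f u) (f v) (f X) (f Y) (f Z).
Proof. by rewrite /flexder2 !(fE, fA, fB). Qed.
Let fder3 : f (flexder3 u v X Y Z) = flexder3 (f u) (f v) (f X) (f Y) (f Z).
Proof. by rewrite /flexder3 !(fE, fA, fB). Qed.
Lemma rmorph_triplex :
  f (triplex u v X Y Z) = triplex (f u) (f v) (f X) (f Y) (f Z).
Proof. by rewrite /triplex !(fE, rmorph_flexform, fder, fder2). Qed.
Lemma rmorph_tripley :
  f (tripley u v X Y Z) = tripley (f u) (f v) (f X) (f Y) (f Z).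
Proof.
by rewrite /tripley !(fE, rmorph_flexform, fder, fder2, fder3, fA, fB).
Qed.
End Morph.

Section CovariantIdentities.
Variable R : comNzRingType.
Lemma flexform_scale (u v X Y Z a b : R) :
  flexform (a * u) (a * v) (b * X) (b * Y) (b * Z) =
    a ^+ 3 * b ^+ 5 * flexform u v X Y Z.
Proof. rewrite /flexform /cubicZ /cubicY; ring. Qed.
Lemma triplex_scale (u v X Y Z a b : R) :
  triplex (a * u) (a * v) (b * X) (b * Y) (b * Z) =
    a ^+ 8 * b ^+ 12 * triplex u v X Y Z.
Proof.
by rewrite /triplex /flexder2 /flexder /flexform /cubicZ /cubicY; ring.
Qed.
(** The values where the degeneration ends: with u = r^3 sg and v = 1, the
    coordinates (u, v, x, y) of the image become those of
    (r^3 sg, 1, r^2 (1 + sg), r^3 (2 q^3 - 1)(sg - 2) / 2), up to the weighted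
    scaling by 6 r q h. *)
Lemma covariants_X0 (r q : R) (sg := q ^+ 6 - q ^+ 3) :
  let h := flexform (r ^+ 3 * sg) 1 0 1 (r * q ^+ 2) in
  [/\ h = - 9%:R * r ^+ 7 * sg * q ^+ 5,
   4%:R * triplex (r ^+ 3 * sg) 1 0 1 (r * q ^+ 2) = (6%:R * r * q * h) ^+ 2 * (r ^+ 2 * (1 + sg)) &
   2%:R * (4%:R * tripley (r ^+ 3 * sg) 1 0 1 (r * q ^+ 2)) =
    (6%:R * r * q * h) ^+ 3 * (r ^+ 3 * (2%:R * q ^+ 3 - 1) * (sg - 2%:R))].
Proof.
rewrite /sg /triplex /tripley /flexder3 /flexder2 /flexder /flexform /cubicZ /cubicY.
by split; ring.
Qed.

(** From their definitions, the two covariants have degrees 5 and 12 in X, Y, Z.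
    On the cubic with u = s and v = 1, at the point (1 : p : q), their degrees
    drop to 3 and 6: up to constant factors, the first is the Hessian, the
    second the adjugate of the Hessian matrix evaluated on the gradient of the
    Hessian, whose components are minus hX, hY and hZ.  Here t stands for 2 t of
    the sextic.  The upper bound 9 for the degree of the map rests on these
    sharp degrees. *)
Lemma covariants_on_cubic (s p q t : R) (a := s * q - 3%:R * t - p)
  (hX := 2%:R * s ^+ 3 * p + 9%:R * s * t * p * q - 2%:R * q)
  (hY := s ^+ 3 - 3%:R * s ^+ 2 * q ^+ 2 + 6%:R * s * p * q + 9%:R * s * t * q)
  (hZ := 3%:R * s * p ^+ 2 - 6%:R * s ^+ 2 * p * q + 9%:R * s * t * p - 1) :
  t = s * q - s * p ^+ 3 + q ^+ 3 - p ->
  flexform s 1 1 p q = 3%:R * s * p * q * a + q - s ^+ 3 * p /\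
  triplex s 1 1 p q = s ^+ 2 * hY ^+ 2 + hZ ^+ 2 + 2%:R * s * hY * hZ
    + 9%:R * s * p * q * hX ^+ 2 - 3%:R * a * q * hY ^+ 2 + 3%:R * s * a * p * hZ ^+ 2
    - 6%:R * q * hX * hY - 6%:R * s ^+ 2 * p * hX * hZ.
Proof.
rewrite /hX /hY /hZ /a => ->.
rewrite /triplex /flexder3 /flexder2 /flexder /flexform /cubicZ /cubicY.
by split; ring.
Qed.
End CovariantIdentities.

(** * The map to the sextic *)

(** The parameters u = [pencilU] and v = [pencilV] are those of the cubic
    through the point (X : Y : Z).  Dividing by 6 X h, where h is [flexform],
    normalizes the Weierstrass equation of the covariants to the sextic;
    multiplying the coordinates by the powers of [scaleF] = 6 X h given by
    their weights makes them polynomial again. *)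
Section Forms.
Variables (A : comNzRingType) (t X Y Z : A).
Definition pencilU := Z ^+ 3 - X ^+ 2 * Y - 2%:R * t * X ^+ 3.
Definition pencilV := Y ^+ 3 - X ^+ 2 * Z.
Definition scaleF := 6%:R * X * flexform pencilU pencilV X Y Z.
Definition formx := 4%:R * triplex pencilU pencilV X Y Z.
Definition formy := 4%:R * tripley pencilU pencilV X Y Z.

Lemma tripling_on_sextic :
  sextic_at t (scaleF * pencilU) (scaleF * pencilV) formx formy = 0.
Proof.
rewrite /sextic_at /formx /formy /scaleF.
have := triple_syzygy pencilU pencilV X Y Z.
set h := flexform _ _ _ _ _; set x := triplex _ _ _ _ _.
set y := tripley _ _ _ _ _; move=> /= e.
have eT : pencilU * (X ^+ 2 * Z - Y ^+ 3) + pencilV * (Z ^+ 3 - X ^+ 2 * Y)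
    = 2%:R * t * pencilV * X ^+ 3.
  by rewrite /pencilU /pencilV; ring.
rewrite eT in e; move: e; move: pencilU pencilV h x y => u v h x y e.
have -> : (4%:R * y) ^+ 2 = 16%:R * y ^+ 2 by ring.
by rewrite e; ring.
Qed.
End Forms.

Section FormsMorph.
Variables (A B : comNzRingType) (g : {rmorphism A -> B}) (t X Y Z : A).
Lemma rmorph_pencilU : g (pencilU t X Y Z) = pencilU (g t) (g X) (g Y) (g Z).
Proof. by rewrite /pencilU !(rmorphB g, rmorphM g, rmorphXn g, rmorph_nat g). Qed.
Lemma rmorph_pencilV : g (pencilV X Y Z) = pencilV (g X) (g Y) (g Z).
Proof. by rewrite /pencilV !(rmorphB g, rmorphM g, rmorphXn g). Qed.
Lemma rmorph_scaleF : g (scaleF t X Y Z) = scaleF (g t) (g X) (g Y) (g Z).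
Proof.
by rewrite /scaleF !(rmorphM g, rmorph_nat g, rmorph_flexform, rmorph_pencilU, rmorph_pencilV).
Qed.
Lemma rmorph_formx : g (formx t X Y Z) = formx (g t) (g X) (g Y) (g Z).
Proof.
by rewrite /formx !(rmorphM g, rmorph_nat g, rmorph_triplex, rmorph_pencilU, rmorph_pencilV).
Qed.
Lemma rmorph_formy : g (formy t X Y Z) = formy (g t) (g X) (g Y) (g Z).
Proof.
by rewrite /formy !(rmorphM g, rmorph_nat g, rmorph_tripley, rmorph_pencilU, rmorph_pencilV).
Qed.
End FormsMorph.

(** Degrees are computed for an abstract grading H, so that the large
    polynomials are never expanded as elements of a polynomial ring. *)
Section GradedForms.
Variables (A : comNzRingType) (H : nat -> A -> Prop).
Hypothesis HB : forall d p q, H d p -> H d q -> H d (p - q).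
Hypothesis HD : forall d p q, H d p -> H d q -> H d (p + q).
Hypothesis HM : forall d e p q, H d p -> H e q -> H (d + e) (p * q).
Hypothesis Hn : forall n, H 0 n%:R.
Variables (t X Y Z : A).
Hypotheses (Ht : H 0 t) (HX : H 1 X) (HY : H 1 Y) (HZ : H 1 Z).

Let HM' d e k p q : H d p -> H e q -> k = (d + e)%N -> H k (p * q).
Proof. by move=> hp hq ->; exact: HM. Qed.
Let HE d e k p : H d p -> e = (d * k)%N -> H e (p ^+ k).
Proof.
move=> hp ->; elim: k => [|k ih]; first by rewrite muln0 expr0; exact: (Hn 1).
by rewrite mulnS exprS; exact: HM.
Qed.

Ltac graded := lazymatch goal with
  | |- H _ (_ - _) => apply: HB; graded
  | |- H _ (_ + _) => apply: HD; graded
  | |- H _ (_ ^+ _) => eapply HE; [graded | reflexivity]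
  | |- H _ (_ * _) => eapply HM'; [graded | graded | reflexivity]
  | |- H _ _%:R => exact: Hn
  | |- _ => eassumption
  end.

Lemma pencilU_graded : H 3 (pencilU t X Y Z).
Proof. by rewrite /pencilU; graded. Qed.
Lemma pencilV_graded : H 3 (pencilV X Y Z).
Proof. by rewrite /pencilV; graded. Qed.

Section Covariants.
Variables (u v : A).
Hypotheses (Hu : H 3 u) (Hv : H 3 v).
Let HcA : H 5 (cubicZ u v X Z). Proof. by rewrite /cubicZ; graded. Qed.
Let HcB : H 5 (cubicY u v X Y). Proof. by rewrite /cubicY; graded. Qed.
Let Hh : H 14 (flexform u v X Y Z). Proof. by rewrite /flexform; graded. Qed.
Let Hl : H 18 (flexder u v X Y Z). Proof. by rewrite /flexder; graded. Qed.
Let Hm : H 16 (flexder2 u v X Y Z). Proof. by rewrite /flexder2; graded. Qed.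
Let Hm3 : H 20 (flexder3 u v X Y Z). Proof. by rewrite /flexder3; graded. Qed.
Lemma flexform_graded : H 14 (flexform u v X Y Z). Proof. exact: Hh. Qed.
Lemma triplex_graded : H 36 (triplex u v X Y Z).
Proof. by rewrite /triplex; graded. Qed.
Lemma tripley_graded : H 54 (tripley u v X Y Z).
Proof. by rewrite /tripley; graded. Qed.
End Covariants.

Lemma scaleF_graded : H 15 (scaleF t X Y Z).
Proof.
have hU := pencilU_graded; have hV := pencilV_graded.
by have hh := flexform_graded hU hV; rewrite /scaleF; graded.
Qed.
Lemma formx_graded : H 36 (formx t X Y Z).
Proof.
have hh := triplex_graded pencilU_graded pencilV_graded.
by rewrite /formx; graded.
Qed.
Lemma formy_graded : H 54 (formy t X Y Z).
Proof.
have hh := tripley_graded pencilU_graded pencilV_graded.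
by rewrite /formy; graded.
Qed.
End GradedForms.

Section Map.
Variables (K : fieldType) (t : K).
Notation X := ('X_(@Ordinal 3 0 isT) : {mpoly K[3]}).
Notation Y := ('X_(@Ordinal 3 1 isT) : {mpoly K[3]}).
Notation Z := ('X_(@Ordinal 3 2 isT) : {mpoly K[3]}).

Definition formU := scaleF t%:MP X Y Z * pencilU t%:MP X Y Z.
Definition formV := scaleF t%:MP X Y Z * pencilV X Y Z.

Let H d (p : {mpoly K[3]}) : Prop := p \is d.-homog.
Let HB d (p q : {mpoly K[3]}) : H d p -> H d q -> H d (p - q).
Proof. exact: rpredB. Qed.
Let HD d (p q : {mpoly K[3]}) : H d p -> H d q -> H d (p + q).
Proof. exact: rpredD. Qed.
Let HM d e (p q : {mpoly K[3]}) : H d p -> H e q -> H (d + e) (p * q).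
Proof. exact: dhomogM. Qed.
Let Hn n : H 0 n%:R.
Proof. by rewrite /H rpredMn // dhomog1. Qed.
Let Ht : H 0 t%:MP.
Proof. by rewrite /H -(mulr1 t%:MP) mul_mpolyC dhomogZ // dhomog1. Qed.
Let HX i : H 1 'X_i.
Proof. by apply: dhomogXU; exact: mdeg1. Qed.

Lemma formUV_homog : formU \is 18.-homog /\ formV \is 18.-homog.
Proof.
have hs := scaleF_graded HB HD HM Hn Ht (HX _) (HX _) (HX _).
split; apply: (HM (d := 15) (e := 3) (hs _ _ _)).
  exact: (pencilU_graded HB HM Hn Ht).
exact: (pencilV_graded HB HM Hn).
Qed.

Definition coords : 4.-tuple {mpoly K[3]} :=
  [tuple formU; formV; formx t%:MP X Y Z; formy t%:MP X Y Z].

Lemma coords_homog i : tnth coords i \is (18 * tnth w1123 i).-homog.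
Proof.
have [hU hV] := formUV_homog.
case: i => -[|[|[|[|//]]]] lt; rewrite !(tnth_nth 0) /=.
- exact: hU.
- exact: hV.
- exact: (formx_graded HB HD HM Hn Ht).
- exact: (formy_graded HB HD HM Hn Ht).
Qed.

Lemma comp_sextic : sextic t \mPo coords = 0.
Proof.
rewrite sexticE [LHS](rmorph_sextic_at (@comp_mpoly 4 K 3 coords)) /=.
rewrite !comp_mpolyXU comp_mpolyC; exact: tripling_on_sextic.
Qed.
End Map.

(** * Independence after degeneration *)

Lemma sum_distinct_sizes (A : nzRingType) (J : finType) (F : J -> {poly A}) :
  (forall i j, F i != 0 -> F j != 0 -> size (F i) = size (F j) -> i = j) ->
  \sum_i F i = 0 -> forall i, F i = 0.
Proof.
move=> dist sF i; apply/eqP; apply: contraT => Fi.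
have [j Fj jmax] := @arg_maxnP J i (fun j => F j != 0) (fun j => size (F j)) Fi.
case/negP: (Fj); rewrite -lead_coef_eq0; apply/eqP.
rewrite -[RHS](coef0 _ (size (F j)).-1) -sF coef_sum (bigD1 j) //= big1 ?addr0 // => k kj.
have [->|Fk] := eqVneq (F k) 0; first by rewrite coef0.
have kj' : size (F k) != size (F j) by apply: contraNneq kj => /(dist _ _ Fk Fj) ->.
have lt : (size (F k) < size (F j))%N by rewrite ltn_neqAle kj'; apply: jmax.
by rewrite nth_default // -ltnS prednK // (leq_ltn_trans _ lt).
Qed.

(** The degenerate image has coordinates u = rho^3 sg, v = 1, x = rho^2 (1 + sg)
    and, up to a constant, y = rho^3 psi, with sg and psi of degrees 6 and 9
    in q. *)
Section Independence.
Variable C : fieldType.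

Let sg : {poly C} := 'X^6 - 'X^3.
Let psi : {poly C} := (2%:R *: 'X^3 - 1) * (sg - 2%:R).
Hypothesis two0 : 2%:R != 0 :> C.

Let size_sg : size sg = 7.
Proof. by rewrite /sg size_polyDl size_polyXn // size_polyN size_polyXn. Qed.

Let size_psi : size psi = 10.
Proof.
have s1 : size (2%:R *: 'X^3 - 1 : {poly C}) = 4.
  by rewrite size_polyDl size_scale ?size_polyXn // size_polyN size_poly1.
have s2 : size (sg - 2%:R) = 7.
  by rewrite size_polyDl size_sg // size_polyN -polyC_natr (leq_ltn_trans (size_polyC_leq1 _)).
rewrite size_mul ?s1 ?s2 // -size_poly_eq0 ?s1 ?s2 //.
Qed.

(** The degrees in q are 6 deg B + 9 eps + r, and 9 eps + r runs through all
    residues modulo 6 for r < 3 and eps < 2. *)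
Lemma sextic_basis_free (B : 'I_3 * 'I_2 -> {poly C}) :
  \sum_k (B k \Po sg) * psi ^+ k.2 * 'X^(k.1) = 0 -> forall k, B k = 0.
Proof.
have sz k : B k != 0 ->
    size ((B k \Po sg) * psi ^+ k.2 * 'X^(k.1)) = ((size (B k)).-1 * 6 + k.2 * 9 + k.1).+1.
  move=> Bk; have c0 : B k \Po sg != 0.
    by rewrite comp_poly_eq0 ?size_sg.
  have p0 : psi ^+ k.2 != 0 by rewrite expf_neq0 // -size_poly_eq0 size_psi.
  have szB : size (B k \Po sg) = ((size (B k)).-1 * 6).+1.
    by rewrite -[LHS]prednK ?size_poly_gt0 // size_comp_poly size_sg.
  rewrite size_mulXn ?mulf_neq0 // size_mul // szB.
  have -> : size (psi ^+ k.2) = (k.2 * 9).+1.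
    case: k p0 {Bk c0 szB} => i [[|[|//]] ? /=] _; first by rewrite expr0 size_poly1.
    by rewrite expr1 size_psi.
  by rewrite addSn addnS /= addnC addSn; congr _.+1; lia.
move=> s0 k; apply/eqP; apply: contraT => Bk.
have nz i : B i != 0 -> (B i \Po sg) * psi ^+ i.2 * 'X^(i.1) != 0.
  by move=> Bi; rewrite -size_poly_eq0 sz.
have zn i : (B i \Po sg) * psi ^+ i.2 * 'X^(i.1) != 0 -> B i != 0.
  by apply: contraNneq => ->; rewrite comp_poly0 !mul0r.
case/negP: (nz k Bk); apply/eqP; move: k {Bk}; apply: sum_distinct_sizes => // i j /zn Bi /zn Bj.
rewrite !sz // => -[e]; case: i j e {Bi Bj} => [i e] [j e'] /= h.
have := ltn_ord i; have := ltn_ord j; have := ltn_ord e; have := ltn_ord e' => h1 h2 h3 h4.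
by congr (_, _); apply: val_inj => /=; lia.
Qed.

(** Take the smallest order of vanishing at -1 among the terms with a nonzero
    coefficient; it is attained only once. *)
Lemma shifted_monomials_free (I : finType) (P : pred I) (a c : I -> nat) (g : I -> C) :
  {in P &, forall i j, c i = c j -> i = j} ->
  \sum_(i | P i) g i *: ('X^(a i) * (1 + 'X) ^+ c i) = 0 ->
  {in P, forall i, g i = 0}.
Proof.
move=> inj s0 i; move: {2}(c i).+1 (ltnSn (c i)) => n; elim: n i => // n ih i ci Pi.
have [cin|] := ltnP (c i) n; first exact: ih.
rewrite ltnS in ci; move=> nci; have {nci ci} ci : c i = n by lia.
have := congr1 (fun p => (p \Po ('X - 1))`_n) s0.
rewrite comp_poly0 coef0 rmorph_sum coef_sum (bigD1 i) //= big1 ?addr0 => [|j /andP[Pj ji]].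
  rewrite comp_polyZ rmorphM !rmorphXn rmorphD /= comp_polyX rmorph1 addrCA subrr addr0.
  rewrite coefZ coefMXn ci ltnn subnn -horner_coef0 horner_exp !hornerE.
  by move/eqP; rewrite mulf_eq0 signr_eq0 orbF => /eqP.
rewrite comp_polyZ rmorphM !rmorphXn rmorphD /= comp_polyX rmorph1 addrCA subrr addr0.
rewrite coefZ coefMXn; have [cj|cj] := ltnP n (c j); first by rewrite mulr0.
have [cj'|] := ltnP (c j) n; first by rewrite ih // mul0r.
move=> nc; case/eqP: ji; apply: inj => //; lia.
Qed.

Variables (I : finType) (r j eps c a : I -> nat).
Hypothesis r3 : forall i, (r i < 3)%N.
Hypothesis j3 : forall i, (j i < 3)%N.
Hypothesis e2 : forall i, (eps i < 2)%N.
Hypothesis inj : forall i k, r i = r k -> j i = j k -> eps i = eps k ->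
  c i = c k -> a i = a k -> i = k.

Let rho : {poly {poly C}} := 'X.
Let w i := (3 * a i + 2 * c i + 3 * eps i + (6 - j i))%N.

Let regroup (A : comNzRingType) (G S P Q T : A) k l e m n :
  G * ((T ^+ 3 * S) ^+ k * (T ^+ 2 * (1 + S)) ^+ l * (T ^+ 3 * P) ^+ e * T ^+ m * Q ^+ n)
  = G * (S ^+ k * (1 + S) ^+ l) * P ^+ e * Q ^+ n * T ^+ (3 * k + 2 * l + 3 * e + m)%N.
Proof.
by rewrite !exprMn !exprD expr0; ring.
Qed.

(** The degree in rho fixes 3 a + 2 c + 3 eps - j, the degree in q modulo 6
    fixes r and eps, and the order of vanishing at sg = -1, where the
    coordinate x is 0, fixes c; then 3 a - j with j < 3 fixes a and j. *)
Lemma degenerate_monomials_free (g : I -> C) :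
  \sum_i (g i)%:P%:P * ((rho ^+ 3 * sg%:P) ^+ a i * (rho ^+ 2 * (1 + sg%:P)) ^+ c i
     * (rho ^+ 3 * psi%:P) ^+ eps i * rho ^+ (6 - j i) * ('X^(r i))%:P) = 0 ->
  forall i, g i = 0.
Proof.
move=> s0.
have E i : (g i)%:P%:P * ((rho ^+ 3 * sg%:P) ^+ a i * (rho ^+ 2 * (1 + sg%:P)) ^+ c i
     * (rho ^+ 3 * psi%:P) ^+ eps i * rho ^+ (6 - j i) * ('X^(r i))%:P) =
   (((g i *: ('X^(a i) * (1 + 'X) ^+ c i)) \Po sg) * psi ^+ eps i * 'X^(r i))%:P * 'X^(w i).
  have ec : ('X^(a i) * (1 + 'X) ^+ c i) \Po sg = sg ^+ a i * (1 + sg) ^+ c i.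
    by rewrite rmorphM !rmorphXn rmorphD /= rmorph1 comp_polyX.
  rewrite comp_polyZ ec -mul_polyC [('X^(r i))%:P]polyC_exp [LHS]regroup.
  rewrite /w; move: sg psi => S P {ec}.
  by rewrite !polyCM !polyC_exp polyCD polyC1.
move=> i0.
have {}s0 : \sum_(i | w i == w i0)
    ((g i *: ('X^(a i) * (1 + 'X) ^+ c i)) \Po sg) * psi ^+ eps i * 'X^(r i) = 0.
  rewrite big_mkcond -[RHS](coef0 _ (w i0)) -s0 coef_sum; apply: eq_bigr => i _.
  by rewrite E coefCM coefXn eq_sym; case: eqP; rewrite ?mulr1 ?mulr0.
pose B (k : 'I_3 * 'I_2) := \sum_(i | [&& w i == w i0, r i == k.1 & eps i == k.2])
   g i *: ('X^(a i) * (1 + 'X) ^+ c i).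
have B0 : forall k, B k = 0.
  apply: sextic_basis_free; rewrite -[RHS]s0.
  rewrite [RHS](partition_big (fun i => (Ordinal (r3 i), Ordinal (e2 i))) xpredT) //=.
  apply: eq_bigr => -[r0 e0] _; rewrite /B /= rmorph_sum !mulr_suml /=.
  apply: eq_big => [i|i /and3P[_ /eqP <- /eqP <-] //].
  by congr (_ && _); rewrite xpair_eqE -!val_eqE.
have := B0 (Ordinal (r3 i0), Ordinal (e2 i0)); rewrite /B /= => {}B0.
apply: (shifted_monomials_free _ B0); last by rewrite unfold_in !eqxx.
move=> i k; rewrite !unfold_in => /and3P[/eqP wi /eqP ri /eqP ei] /and3P[/eqP wk /eqP rk /eqP ek] cik.
have := j3 i; have := j3 k; move: wi; rewrite -wk /w => wi hk hi.
by apply: inj => //; lia.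
Qed.

End Independence.

(** * Independence over the function field of the sextic *)

Lemma weight_complement e a c eps : (a + 2 * c + 3 * eps <= e)%N ->
  e = (a + (e - (a + 2 * c + 3 * eps)) + 2 * c + 3 * eps)%N.
Proof. lia. Qed.

Lemma basis_exponents r j : (r < 3)%N -> (j < 3)%N ->
  (6 + r = (6 - r - 2 * j) + 2 * (r + j))%N /\
  (6 - j = (6 - r - 2 * j) + (r + j))%N.
Proof. lia. Qed.

(** The degeneration t -> oo.  Put t = 1 / (2 nu^3) and evaluate at
    (X, Y, Z) = (nu rho q, 1, rho q^2), where rho and q (here [qq]) are
    independent: then 2 t X^3 = (rho q)^3 stays finite, and at nu = 0 the
    pencil becomes spanned by Y^3 and Z^3 - W^3, where W stands for X / nu.
    C(t) embeds into the fraction field [Om] of the polynomials in nu. *)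
Section Specialization.
Variable C : fieldType.
Hypothesis char0 : forall n, n.+1%:R != 0 :> C.
Variables (D : idomainType) (Om : fieldType).
Variables (iota : {rmorphism C -> D}) (emb : {rmorphism {poly D} -> Om}).
Hypothesis emb_inj : injective emb.
Notation K := {fraction {poly C}}.

Let emb_eq0 p : (emb p == 0) = (p == 0).
Proof. by rewrite -(inj_eq emb_inj) rmorph0. Qed.
Let beta : {rmorphism C -> Om} := emb \o ((@polyC D) \o iota).
Let nu : {poly D} := 'X.
Let tau : Om := (2%:R * emb nu ^+ 3)^-1.
Let phi : {rmorphism {poly C} -> Om} := horner_eval tau \o map_poly beta.

Let nu0 : emb nu != 0 :> Om.
Proof. by rewrite emb_eq0 -size_poly_eq0 size_polyX. Qed.

Let two0 : 2%:R != 0 :> Om.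
Proof. by rewrite -(rmorph_nat beta) fmorph_eq0 char0. Qed.

Let tau_nu : 2%:R * tau * emb nu ^+ 3 = 1.
Proof.
have nz : 2%:R * emb nu ^+ 3 != 0 by rewrite mulf_neq0 // expf_neq0.
by rewrite mulrAC; exact: (divff nz).
Qed.

Let phiZX c k : phi (c *: 'X^k) = beta c * tau ^+ k.
Proof.
by rewrite /phi /= -mul_polyC rmorphM /= map_polyC map_polyXn /horner_eval hornerM hornerC hornerXn.
Qed.

Let embZX c k : emb (map_poly iota (c *: 'X^k)) = beta c * emb nu ^+ k.
Proof. by rewrite map_polyZ map_polyXn -mul_polyC rmorphM rmorphXn. Qed.

(** nu^(3 N) a(1 / (2 nu^3)) as a polynomial in nu, when N is at least the size
    of a. *)
Let reversed N (a : {poly C}) : {poly C} :=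
  \sum_(k < size a) (a`_k / 2%:R ^+ k) *: 'X^(3 * (N - k)).

Let phi_reversed N (a : {poly C}) : (size a <= N)%N ->
  phi a * emb nu ^+ (3 * N) = emb (map_poly iota (reversed N a)).
Proof.
move=> sa; have -> : phi a = \sum_(k < size a) phi (a`_k *: 'X^k).
  by rewrite -(raddf_sum phi) -poly_def coefK.
rewrite /reversed (raddf_sum (map_poly iota)) (raddf_sum emb) big_distrl.
apply: eq_bigr => k _; rewrite [LHS](congr1 ( *%R^~ _) (phiZX _ _)).
rewrite [RHS]embZX (rmorphM beta) (fmorphV beta) (rmorphXn beta) (rmorph_nat beta) -!mulrA.
congr (_ * _).
have kN : (k <= N)%N by rewrite (leq_trans (ltnW (ltn_ord k)) sa).
rewrite -{1}(subnKC kN) mulnDr exprD mulrA exprM -exprMn.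
congr (_ * _); rewrite -exprVn; congr (_ ^+ _).
by apply: (mulfI two0); rewrite mulrA tau_nu divff.
Qed.

Let reversed_eq0 N (a : {poly C}) : (size a <= N)%N -> reversed N a = 0 -> a = 0.
Proof.
move=> sa r0; apply/polyP => k; rewrite coef0.
have [ks|ks] := leqP (size a) k; first by rewrite nth_default.
have := congr1 (fun p : {poly C} => p`_(3 * (N - k))) r0.
rewrite coef0 coef_sum (bigD1 (Ordinal ks)) //= big1 ?addr0 => [|l lk].
  rewrite coefZ coefXn eqxx mulr1 => /eqP; rewrite mulf_eq0 invr_eq0 expf_eq0.
  by rewrite (negPf (char0 1)) andbF orbF => /eqP.
rewrite coefZ coefXn; case: eqP => [e|]; last by rewrite mulr0.
case/eqP: lk; apply: val_inj => /=; have := ltn_ord l; move: e sa ks; lia.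
Qed.

Let phi_inj : injective phi.
Proof.
apply: raddf_inj => a a0; apply: (@reversed_eq0 (size a)) => //.
apply: (@map_inj_poly _ _ iota (fmorph_inj iota)); rewrite ?rmorph0 //.
by apply/eqP; rewrite -emb_eq0 -phi_reversed // a0 mul0r.
Qed.

Let kappa : {rmorphism K -> Om} := frac_lift phi_inj.

Variables (rho qq : D).
Hypotheses (rho0 : rho != 0) (qq0 : qq != 0).
Let xh : {poly D} := nu * (rho * qq)%:P.
Let zh : {poly D} := (rho * qq ^+ 2)%:P.
Let uh : {poly D} := zh ^+ 3 - xh ^+ 2 - ((rho * qq) ^+ 3)%:P.
Let vh : {poly D} := pencilV xh 1 zh.
Let hh := flexform uh vh xh 1 zh.
Let lh := 6%:R * (rho * qq)%:P * hh.
Let txh := 4%:R * triplex uh vh xh 1 zh.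
Let tyh := 4%:R * tripley uh vh xh 1 zh.

Let pU : pencilU tau (emb xh) 1 (emb zh) = emb uh.
Proof.
rewrite /pencilU /uh !rmorphB !rmorphXn /= mulr1; congr (_ - _).
rewrite /xh rmorphM /= exprMn mulrA tau_nu mul1r.
by rewrite ?rmorphXn.
Qed.
Let pV : pencilV (emb xh) 1 (emb zh) = emb vh.
Proof. by rewrite [RHS](rmorph_pencilV emb) rmorph1. Qed.

Let pL : scaleF tau (emb xh) 1 (emb zh) = emb (nu * lh).
Proof.
rewrite /scaleF pU pV -[X in flexform _ _ _ X _](rmorph1 emb).
rewrite -rmorph_flexform -/hh /lh -(rmorph_nat emb) -!rmorphM /=.
by congr (emb _); rewrite /xh; move: nu (_%:P) hh => *; ring.
Qed.
Let px : formx tau (emb xh) 1 (emb zh) = emb txh.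
Proof.
rewrite /formx pU pV -[X in triplex _ _ _ X _](rmorph1 emb).
by rewrite -rmorph_triplex -(rmorph_nat emb) -rmorphM.
Qed.
Let py : formy tau (emb xh) 1 (emb zh) = emb tyh.
Proof.
rewrite /formy pU pV -[X in tripley _ _ _ X _](rmorph1 emb).
by rewrite -rmorph_tripley -(rmorph_nat emb) -rmorphM.
Qed.

Let sg : D := qq ^+ 6 - qq ^+ 3.
Let ev0 : {rmorphism {poly D} -> D} := horner_eval 0.
Let h0 : D := flexform (rho ^+ 3 * sg) 1 0 1 (rho * qq ^+ 2).
Let lam0 : D := 6%:R * rho * qq * h0.

Let ev0x : ev0 xh = 0.
Proof. by rewrite /ev0 /= /horner_eval /xh hornerM hornerX mul0r. Qed.
Let ev0z : ev0 zh = rho * qq ^+ 2.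
Proof. by rewrite /ev0 /= /horner_eval /zh hornerC. Qed.
Let ev0C c : ev0 c%:P = c.
Proof. by rewrite /ev0 /= /horner_eval hornerC. Qed.
Let ev0u : ev0 uh = rho ^+ 3 * sg.
Proof.
rewrite /uh !rmorphB !rmorphXn ev0x ev0z ev0C /sg; ring.
Qed.
Let ev0v : ev0 vh = 1.
Proof.
by rewrite [LHS](rmorph_pencilV ev0) ev0x ev0z rmorph1 /pencilV; ring.
Qed.
Let ev0h : ev0 hh = h0.
Proof. by rewrite /hh rmorph_flexform ev0u ev0v ev0x ev0z rmorph1. Qed.
Let ev0l : ev0 lh = lam0.
Proof. by rewrite /lh !rmorphM rmorph_nat !ev0C ev0h /lam0; ring. Qed.
Let psi : D := (2%:R * qq ^+ 3 - 1) * (sg - 2%:R).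
Let ev0tx : ev0 txh = lam0 ^+ 2 * (rho ^+ 2 * (1 + sg)).
Proof.
rewrite /txh rmorphM rmorph_nat rmorph_triplex ev0u ev0v ev0x ev0z rmorph1.
by have [_ -> _] := covariants_X0 rho qq.
Qed.
Let ev0ty : ev0 tyh = iota 2%:R^-1 * lam0 ^+ 3 * (rho ^+ 3 * psi).
Proof.
rewrite /tyh rmorphM rmorph_nat rmorph_tripley ev0u ev0v ev0x ev0z rmorph1.
have [_ _ e] := covariants_X0 rho qq.
have i2 : iota 2%:R^-1 * 2%:R = 1.
  by rewrite -(rmorph_nat iota) -rmorphM mulVf ?rmorph1.
rewrite -[LHS]mul1r -[X in X * _]i2 -mulrA e /psi -/sg -/h0 -/lam0.
by move: (iota _) lam0 rho sg (2%:R * qq ^+ 3 - 1) => *; ring.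
Qed.

Hypothesis sg0 : sg != 0.
Let lam0_neq0 : lam0 != 0.
Proof.
have [e _ _] := covariants_X0 rho qq.
have nD n : n.+1%:R != 0 :> D.
  by rewrite -(rmorph_nat iota) fmorph_eq0 char0.
by rewrite /lam0 /h0 e -/sg mulNr !mulf_neq0 ?oppr_eq0 ?mulf_neq0 ?expf_neq0.
Qed.

Notation X := ('X_(@Ordinal 3 0 isT) : {mpoly K[3]}).
Notation Y := ('X_(@Ordinal 3 1 isT) : {mpoly K[3]}).
Notation Z := ('X_(@Ordinal 3 2 isT) : {mpoly K[3]}).
Let t : K := tofrac 'X.
Let pts (i : 'I_3) : Om := nth 0 [:: emb xh; 1; emb zh] i.
Let Phi : {rmorphism {mpoly K[3]} -> Om} := mmap kappa pts.

Let PhiXU i : Phi 'X_i = pts i. Proof. by rewrite /Phi /= mmapX mmap1U. Qed.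
Let PhiX : Phi X = emb xh. Proof. exact: PhiXU. Qed.
Let PhiY : Phi Y = 1. Proof. exact: PhiXU. Qed.
Let PhiZ : Phi Z = emb zh. Proof. exact: PhiXU. Qed.
Let Phit : Phi t%:MP = tau.
Proof.
rewrite /Phi /= mmapC /kappa /= frac_lift_tofrac /phi /= map_polyX.
by rewrite /horner_eval hornerX.
Qed.

Let PhiU : Phi (formU t) = emb (nu * lh * uh).
Proof.
rewrite /formU rmorphM (rmorph_scaleF Phi) (rmorph_pencilU Phi).
by rewrite PhiX PhiY PhiZ Phit pL pU -rmorphM.
Qed.
Let PhiV : Phi (formV t) = emb (nu * lh * vh).
Proof.
rewrite /formV rmorphM (rmorph_scaleF Phi) (rmorph_pencilV Phi).
by rewrite PhiX PhiY PhiZ Phit pL pV -rmorphM.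
Qed.
Let Phix : Phi (formx t%:MP X Y Z) = emb txh.
Proof. by rewrite (rmorph_formx Phi) PhiX PhiY PhiZ Phit px. Qed.
Let Phiy : Phi (formy t%:MP X Y Z) = emb tyh.
Proof. by rewrite (rmorph_formy Phi) PhiX PhiY PhiZ Phit py. Qed.

Variables (I : finType) (e : nat) (r j eps c a : I -> nat).
Hypothesis r3 : forall i, (r i < 3)%N.
Hypothesis j3 : forall i, (j i < 3)%N.
Hypothesis e2 : forall i, (eps i < 2)%N.
Hypothesis we : forall i, (a i + 2 * c i + 3 * eps i <= e)%N.
Hypothesis deg_free : forall g : I -> C,
  \sum_i iota (g i) * ((rho ^+ 3 * sg) ^+ a i * (rho ^+ 2 * (1 + sg)) ^+ c i
     * (rho ^+ 3 * psi) ^+ eps i * rho ^+ (6 - j i) * qq ^+ r i) = 0 ->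
  forall i, g i = 0.

Let b i := (e - (a i + 2 * c i + 3 * eps i))%N.
(** The image of the i-th term without the power of nu that it contains. *)
Let W i : {poly D} := (lh * uh) ^+ a i * (lh * vh) ^+ b i * txh ^+ c i * tyh ^+ eps i
  * ((rho * qq) ^+ (6 - r i - 2 * j i))%:P * zh ^+ (r i + j i).

Let W_free (g : I -> C) : \sum_i iota (g i) * (W i)`_0 = 0 -> forall i, g i = 0.
Proof.
move=> s0.
have h2 : 2%:R^-1 != 0 :> C by rewrite invr_eq0 char0.
suff fr : forall i, g i * 2%:R^-1 ^+ eps i = 0.
  by move=> i; move/eqP: (fr i); rewrite mulf_eq0 expf_eq0 (negPf h2) andbF orbF => /eqP.
apply: deg_free.
have N0 : lam0 ^+ e * qq ^+ 6 != 0 by rewrite mulf_neq0 // expf_neq0.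
apply: (mulfI N0); rewrite mulr0 -[RHS]s0 big_distrr /=; apply: eq_bigr => i _.
have ev00 (p : {poly D}) : p`_0 = ev0 p by rewrite -horner_coef0.
rewrite ev00 /W (rmorphM iota) (rmorphXn iota).
move: (lh) (uh) (vh) (txh) (tyh) (zh) ev0l ev0u ev0v ev0tx ev0ty ev0z.
move=> L U V TX TY ZZ eL eU eV eTX eTY eZ.
rewrite !(rmorphM ev0) !(rmorphXn ev0) ev0C !(rmorphM ev0) eL eU eV eTX eTY eZ.
have ee : e = (a i + b i + 2 * c i + 3 * eps i)%N.
  exact: weight_complement (we i).
have [e6 ej] := basis_exponents (r3 i) (j3 i).
rewrite mulr1; transitivity (iota (g i) * iota 2%:R^-1 ^+ eps i * lam0 ^+ e *
   ((rho ^+ 3 * sg) ^+ a i * (rho ^+ 2 * (1 + sg)) ^+ c i * (rho ^+ 3 * psi) ^+ eps i)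
   * rho ^+ (6 - j i) * qq ^+ (6 + r i)).
  by rewrite exprD; move: (_ ^+ a i) (_ ^+ c i) (_ ^+ eps i) => *; ring.
rewrite ee e6 ej; move: (6 - r i - 2 * j i)%N (r i + j i)%N => k l.
move: (iota _) (iota _) sg psi => G i2 S P.
by rewrite !exprMn !exprD ?expr0; ring.
Qed.

Let term i := formU t ^+ a i * formV t ^+ b i * formx t%:MP X Y Z ^+ c i
  * formy t%:MP X Y Z ^+ eps i * (X ^+ (6 - r i - 2 * j i) * Y ^+ j i * Z ^+ (r i + j i)).

Let n i := (a i + b i + (6 - r i - 2 * j i))%N.

Let Phi_term i : Phi (term i) = emb (nu ^+ n i * W i).
Proof.
rewrite /term !(rmorphM Phi) !(rmorphXn Phi) PhiU PhiV Phix Phiy PhiX PhiY PhiZ.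
rewrite -!(rmorphXn emb) expr1n mulr1 -!(rmorphM emb); congr (emb _).
rewrite /W /xh /n; move: (lh) (uh) (vh) (txh) (tyh) (zh) => L U V TX TY ZZ.
rewrite polyC_exp; move: (rho * qq)%:P => Q.
by rewrite !exprD !exprMn; ring.
Qed.

(** A relation over C(t) becomes, once its denominators are cleared, a relation
    with coefficients in C[nu] between the W i, which are independent at
    nu = 0. *)
Lemma specialized_free (g : I -> K) : \sum_i g i *: term i = 0 -> forall i, g i = 0.
Proof.
move=> s0; have [d [al [d0 gal]]] := common_denominator g.
have dK : tofrac d != 0 :> K by rewrite tofrac_eq0.
suff al0 : forall i, al i = 0.
  by move=> i; apply: (mulIf dK); rewrite gal al0 mul0r tofrac0.
pose N := \max_i size (al i).
have szN i : (size (al i) <= N)%N by apply: (leq_bigmax i).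
have W0 := specialize_free W_free (P := fun i => reversed N (al i) * 'X^(n i)).
suff rev0 : forall i, reversed N (al i) * 'X^(n i) = 0.
  move=> i; apply: (reversed_eq0 (szN i)).
  move/eqP: (rev0 i); rewrite mulf_eq0 => /orP [/eqP //|].
  by rewrite expf_eq0 -size_poly_eq0 size_polyX andbF.
apply: W0; apply: emb_inj; rewrite rmorph0.
have kt i : kappa (g i) * kappa (tofrac d) = phi (al i).
  by rewrite -(rmorphM kappa) gal; exact: frac_lift_tofrac.
have := congr1 Phi s0; rewrite rmorph0 (raddf_sum Phi).
move/(congr1 (fun z => z * (kappa (tofrac d) * emb nu ^+ (3 * N)))).
rewrite mul0r big_distrl => <-; rewrite (raddf_sum emb); apply: eq_bigr => i _.
rewrite /= (_ : Phi (g i *: term i) = kappa (g i) * Phi (term i)); last exact: mmapZ.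
transitivity (emb (map_poly iota (reversed N (al i))) * emb (nu ^+ n i * W i)).
  rewrite -(rmorphM emb); congr (emb _).
  move: (W i) => Wi; rewrite (rmorphM (map_poly iota)) /= map_polyXn.
  by rewrite mulrA.
rewrite -(phi_reversed (szN i)) -kt Phi_term.
have aux (x y z w : Om) : x * y * z * w = x * w * (y * z) by ring.
exact: aux.
Qed.

End Specialization.

Section Freeness.
Variable C : fieldType.
Hypothesis char0 : forall n, n.+1%:R != 0 :> C.
Notation K := {fraction {poly C}}.
Notation X := ('X_(@Ordinal 3 0 isT) : {mpoly K[3]}).
Notation Y := ('X_(@Ordinal 3 1 isT) : {mpoly K[3]}).
Notation Z := ('X_(@Ordinal 3 2 isT) : {mpoly K[3]}).
Let t : K := tofrac 'X.

(** X^6 q^r (pq)^j with p = Y/X and q = Z/X, the numerators of the basis of the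
    function field of the plane over that of the sextic. *)
Definition basis_form (K : fieldType) (r j : nat) : {mpoly K[3]} :=
  'X_(@Ordinal 3 0 isT) ^+ (6 - r - 2 * j) * 'X_(@Ordinal 3 1 isT) ^+ j
  * 'X_(@Ordinal 3 2 isT) ^+ (r + j).

Definition image_monomial (K : fieldType) (t : K) (e eps c a : nat) : {mpoly K[3]} :=
  formU t ^+ a * formV t ^+ (e - (a + 2 * c + 3 * eps))
  * formx t%:MP 'X_(@Ordinal 3 0 isT) 'X_(@Ordinal 3 1 isT) 'X_(@Ordinal 3 2 isT) ^+ c
  * formy t%:MP 'X_(@Ordinal 3 0 isT) 'X_(@Ordinal 3 1 isT) 'X_(@Ordinal 3 2 isT) ^+ eps.

(** The key independence.  Taken for all reduced monomials of weight e and all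
    nine basis forms, it shows both that the map is dominant and that its
    degree is at least 9. *)
Lemma image_monomials_free (I : finType) (e : nat) (r j eps c a : I -> nat) :
  (forall i, (r i < 3)%N) -> (forall i, (j i < 3)%N) -> (forall i, (eps i < 2)%N) ->
  (forall i, (a i + 2 * c i + 3 * eps i <= e)%N) ->
  (forall i k, r i = r k -> j i = j k -> eps i = eps k -> c i = c k ->
     a i = a k -> i = k) ->
  forall g : I -> K,
  \sum_i g i *: (image_monomial t e (eps i) (c i) (a i) * basis_form K (r i) (j i)) = 0 ->
  forall i, g i = 0.
Proof.
move=> r3 j3 e2 we inj.
pose iota : {rmorphism C -> {poly {poly C}}} := (@polyC {poly C}) \o (@polyC C).
pose rho : {poly {poly C}} := 'X.
pose qq : {poly {poly C}} := 'X%:P.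
have tofrac_inj : injective (@FracField.tofrac {poly {poly {poly C}}}).
  by move=> p q /eqP; rewrite tofrac_eq => /eqP.
have X0 (A : nzRingType) : ('X : {poly A}) != 0 by rewrite -size_poly_eq0 size_polyX.
have sgE : qq ^+ 6 - qq ^+ 3 = ('X^6 - 'X^3)%:P by rewrite polyCB !polyC_exp.
have sg0 : qq ^+ 6 - qq ^+ 3 != 0.
  rewrite sgE polyC_eq0 -size_poly_eq0.
  by rewrite size_polyDl size_polyXn // size_polyN size_polyXn.
have qq0 : qq != 0 by rewrite /qq polyC_eq0 X0.
apply: (specialized_free char0 (iota := iota) tofrac_inj (X0 _) qq0 sg0 r3 j3 we).
move=> g s0; apply: (degenerate_monomials_free (char0 1) r3 j3 e2 inj).
rewrite -[RHS]s0; apply: eq_bigr => i _; rewrite sgE !polyC_exp -/qq /=.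
rewrite (_ : ((2%:R *: 'X^3 - 1) * ('X^6 - 'X^3 - 2%:R))%:P =
   (2%:R * qq ^+ 3 - 1) * (('X^6 - 'X^3)%:P - 2%:R)) //.
rewrite polyCM; congr (_ * _); last by rewrite polyCB polyC_natr.
by rewrite polyCB -mul_polyC [X in X - _]polyCM polyC_exp polyC_natr polyC_natr.
Qed.
End Freeness.

(** * Functions of bounded degree on the cubic *)

Section Span.
Variables (K L : fieldType) (phi : {rmorphism K -> L}) (s p q : L).

(** The span over K of the s^i p^a q^b with i at most I and a + b at most D,
    as an inductive predicate, so that membership is proved along the shape of
    an expression.  The point (p, q) lies on a cubic over K(s). *)
Inductive pspan (I D : nat) : L -> Prop :=
| pspan0 : pspan I D 0
| pspan_cons c i a b z of (i <= I)%N & (a + b <= D)%N & pspan I D z :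
    pspan I D (phi c * (s ^+ i * p ^+ a * q ^+ b) + z).

Lemma pspan_mono I D c i a b : (i <= I)%N -> (a + b <= D)%N ->
  pspan I D (phi c * (s ^+ i * p ^+ a * q ^+ b)).
Proof. by move=> iI abD; rewrite -[X in pspan _ _ X]addr0; apply: pspan_cons => //; exact: pspan0. Qed.

Lemma pspanD I D x y : pspan I D x -> pspan I D y -> pspan I D (x + y).
Proof.
elim=> [|c i a b z iI abD _ ih] Sy; first by rewrite add0r.
by rewrite -addrA; apply: pspan_cons => //; exact: ih.
Qed.

Lemma pspan_weaken I D I' D' x : pspan I D x -> (I <= I')%N -> (D <= D')%N -> pspan I' D' x.
Proof.
move=> Sx II DD; elim: Sx => [|c i a b z iI abD _ ih]; first exact: pspan0.
by apply: pspan_cons => //; [exact: leq_trans II | exact: leq_trans DD].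
Qed.

Lemma pspanM I D I' D' x y : pspan I D x -> pspan I' D' y -> pspan (I + I') (D + D') (x * y).
Proof.
move=> Sx Sy; elim: Sx => [|c i a b z iI abD _ ih]; first by rewrite mul0r; exact: pspan0.
rewrite mulrDl; apply: pspanD ih.
elim: Sy => [|c' i' a' b' z' iI' abD' _ ih']; first by rewrite mulr0; exact: pspan0.
rewrite mulrDr; apply: pspanD ih'.
have -> : phi c * (s ^+ i * p ^+ a * q ^+ b) * (phi c' * (s ^+ i' * p ^+ a' * q ^+ b'))
  = phi (c * c') * (s ^+ (i + i') * p ^+ (a + a') * q ^+ (b + b')).
  by rewrite rmorphM !exprD; ring.
by apply: pspan_mono; lia.
Qed.

Lemma pspanC c : pspan 0%N 0%N (phi c).
Proof. by have := @pspan_mono 0%N 0%N c 0%N 0%N 0%N isT isT; rewrite ?(expr0, mulr1). Qed.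
Lemma pspan_nat n : pspan 0%N 0%N n%:R.
Proof. by rewrite -(rmorph_nat phi); exact: pspanC. Qed.
Lemma pspan_s : pspan 1%N 0%N s.
Proof. by have := @pspan_mono 1%N 0%N 1 1%N 0%N 0%N isT isT; rewrite rmorph1 ?(expr0, expr1, mul1r, mulr1). Qed.
Lemma pspan_p : pspan 0%N 1%N p.
Proof. by have := @pspan_mono 0%N 1%N 1 0%N 1%N 0%N isT isT; rewrite rmorph1 ?(expr0, expr1, mul1r, mulr1). Qed.
Lemma pspan_q : pspan 0%N 1%N q.
Proof. by have := @pspan_mono 0%N 1%N 1 0%N 0%N 1%N isT isT; rewrite rmorph1 ?(expr0, expr1, mul1r, mulr1). Qed.
Lemma pspanX I D k x : pspan I D x -> pspan (I * k) (D * k) (x ^+ k).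
Proof.
move=> Sx; elim: k => [|k ih]; first by rewrite !muln0 expr0; exact: (pspan_nat 1).
by rewrite exprS !mulnS; exact: pspanM.
Qed.
Lemma pspanN I D x : pspan I D x -> pspan I D (- x).
Proof. by move=> Sx; rewrite -mulN1r -(rmorphN1 phi); exact: (pspanM (pspanC _) Sx). Qed.
Lemma pspanB I D x y : pspan I D x -> pspan I D y -> pspan I D (x - y).
Proof. by move=> Sx /pspanN; exact: pspanD. Qed.
Lemma pspan_sum I D (J : Type) (r : seq J) (P : pred J) (F : J -> L) :
  (forall j, P j -> pspan I D (F j)) -> pspan I D (\sum_(j <- r | P j) F j).
Proof. by move=> SF; elim/big_ind: _ => //; [exact: pspan0 | exact: pspanD]. Qed.

Variable c0 : K.
Hypothesis cubic : q ^+ 3 = s * p ^+ 3 - s * q + p + phi c0.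

Let Idx N D : finType := ('I_N.+1 * 'I_D.+1 * 'I_3)%type.
Let mon N D (x : Idx N D) := s ^+ x.1.1 * p ^+ x.1.2 * q ^+ x.2.
Let Red N D z := exists c : Idx N D -> K, z = \sum_x phi (c x) * mon x.

Let RedD N D x y : Red N D x -> Red N D y -> Red N D (x + y).
Proof.
move=> [c ->] [d ->]; exists (fun x => c x + d x).
by rewrite -big_split /=; apply: eq_bigr => i _; rewrite rmorphD mulrDl.
Qed.
Let RedZ N D c x : Red N D x -> Red N D (phi c * x).
Proof.
move=> [d ->]; exists (fun x => c * d x).
by rewrite big_distrr /=; apply: eq_bigr => i _; rewrite rmorphM mulrA.
Qed.
Let Red0 N D : Red N D 0.
Proof. by exists (fun=> 0); rewrite big1 // => i _; rewrite rmorph0 mul0r. Qed.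

(** Substituting for q^3 lowers the exponent of q by at least 2 and raises the
   degree in s by at most 1, without raising the total degree in p and q. *)
Let Red_mono N D b : forall i a, (i + b <= N)%N -> (a + b <= D)%N ->
  Red N D (s ^+ i * p ^+ a * q ^+ b).
Proof.
have [n] := ubnP b; elim: n b => // n ih b bn i a iN aD.
have [b3|b3] := ltnP b 3.
  have hi : (i < N.+1)%N by lia.
  have ha : (a < D.+1)%N by lia.
  exists (fun x => (x == (Ordinal hi, Ordinal ha, Ordinal b3))%:R).
  rewrite (bigD1 (Ordinal hi, Ordinal ha, Ordinal b3)) //= eqxx rmorph1 mul1r.
  by rewrite big1 ?addr0 // => x /negPf ->; rewrite rmorph0 mul0r.
have [b' bE] : exists b', b = b'.+3 by exists (b - 3)%N; lia.
have -> : s ^+ i * p ^+ a * q ^+ b =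
  s ^+ i.+1 * p ^+ a.+3 * q ^+ b' + phi (-1) * (s ^+ i.+1 * p ^+ a * q ^+ b'.+1)
  + s ^+ i * p ^+ a.+1 * q ^+ b' + phi c0 * (s ^+ i * p ^+ a * q ^+ b').
  rewrite bE -(addn3 b') exprD cubic rmorphN1 -(addn3 a) -(addn1 i) -(addn1 a) -(addn1 b') !exprD.
  by ring.
by apply: RedD; [apply: RedD; [apply: RedD; [|apply: RedZ]|]|apply: RedZ]; apply: ih; lia.
Qed.

(** Functions of degree at most D on a plane cubic: q^3 is eliminated, so that
    about 3 D monomials in p and q suffice.  The price is a degree in s that is
    larger by D at most. *)
Lemma pspan_reduce I D z : pspan I D z -> Red (I + D) D z.
Proof.
elim=> [|c i a b y iI abD _ ih]; first exact: Red0.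
by apply: RedD ih; apply: RedZ; apply: Red_mono; lia.
Qed.
End Span.

Section CovariantDegrees.
Variables (K L : fieldType) (phi : {rmorphism K -> L}) (s p q : L) (c0 : K).
Hypothesis cubic : q ^+ 3 = s * p ^+ 3 - s * q + p + phi c0.
Notation S := (pspan phi s p q).

Let S_weak I D I' D' x : S I' D' x -> (I' <= I)%N && (D' <= D)%N -> S I D x.
Proof. by move=> Sx /andP[]; exact: pspan_weaken. Qed.

Ltac span_prod := lazymatch goal with
  | |- pspan _ _ _ _ _ _ (_ ^+ _) => eapply pspanX; span_prod
  | |- pspan _ _ _ _ _ _ (_ * _) => eapply pspanM; span_prod
  | |- pspan _ _ _ _ _ _ (_ %:R) => eapply pspan_nat
  | |- pspan _ _ _ _ _ _ 1 => exact: (pspan_nat phi s p q 1)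
  | |- pspan _ s _ _ _ _ s => exact: pspan_s
  | |- pspan _ _ p _ _ _ p => exact: pspan_p
  | |- pspan _ _ _ q _ _ q => exact: pspan_q
  | |- pspan _ _ _ _ _ _ (_ c0) => exact: pspanC
  | |- _ => eassumption
  end.
Ltac span := lazymatch goal with
  | |- pspan _ _ _ _ _ _ (_ - _) => apply: pspanB; span
  | |- pspan _ _ _ _ _ _ (_ + _) => apply: pspanD; span
  | |- _ => eapply S_weak; [span_prod | by []]
  end.

Lemma covariants_pspan :
  S 3%N 3%N (flexform s 1 1 p q) /\ S 8%N 6%N (triplex s 1 1 p q).
Proof.
have ec : phi c0 = s * q - s * p ^+ 3 + q ^+ 3 - p by rewrite cubic; ring.
have [-> ->] := covariants_on_cubic ec.
set a := s * q - 3%:R * phi c0 - p.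
set hX := 2%:R * s ^+ 3 * p + 9%:R * s * phi c0 * p * q - 2%:R * q.
set hY := s ^+ 3 - 3%:R * s ^+ 2 * q ^+ 2 + 6%:R * s * p * q + 9%:R * s * phi c0 * q.
set hZ := 3%:R * s * p ^+ 2 - 6%:R * s ^+ 2 * p * q + 9%:R * s * phi c0 * p - 1.
have Sa : S 1%N 1%N a by rewrite /a; span.
have SX : S 3%N 2%N hX by rewrite /hX; span.
have SY : S 3%N 2%N hY by rewrite /hY; span.
have SZ : S 2%N 2%N hZ by rewrite /hZ; span.
by clearbody a hX hY hZ; split; span.
Qed.
End CovariantDegrees.

Section BoundedDegree.
Variables (K L : fieldType) (phi : {rmorphism K -> L}) (s p q : L) (c0 : K).
Hypothesis cubic : q ^+ 3 = s * p ^+ 3 - s * q + p + phi c0.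
Variables (h x : L).
Hypotheses (h0 : h != 0) (Sh : pspan phi s p q 3%N 3%N h) (Sx : pspan phi s p q 8%N 6%N (x * h ^+ 2)).

(** x is a quotient of functions of degree 6 on a plane cubic over K(s), so that
    K(s,p,q) has degree at most 18 over K(s,x); hence 19 functions are
    dependent over K(s,x).  Since 1, x, ..., x^m times the functions z k, all
    multiplied by h^(2 m), have degree at most 6 m + n, they lie in a space of
    dimension 3 (6 m + n + 1), and 19 (m + 1) exceeds this for m = 3 n.  Degrees
    in s at most E on one side and E + 14 m + n on the other do not spoil this
    when E is large: m and E are chosen so that
    19 (m + 1) (E + 1) > 3 (6 m + n + 1) (E + 14 m + n + 1). *)
Lemma bounded_degree (M : finType) (z : M -> L) n :
  (forall k, pspan phi s p q 0%N n (z k)) -> (18 < #|M|)%N ->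
  exists m E, exists2 g : M * 'I_m.+1 * 'I_E.+1 -> K,
    exists k, g k != 0 &
    \sum_k phi (g k) * (s ^+ k.2 * x ^+ k.1.2 * z k.1.1) = 0.
Proof.
move=> Sz M18; pose m := (3 * n)%N; pose E := (43 * n * (57 * n + 3))%N.
exists m, E.
pose v (k : M * 'I_m.+1 * 'I_E.+1) :=
  s ^+ k.2 * (x * h ^+ 2) ^+ k.1.2 * (h ^+ 2) ^+ (m - k.1.2) * z k.1.1.
have Sv k : pspan phi s p q (E + 8 * m) (6 * m + n) (v k).
  case: k => [[k c] a]; have ha := ltn_ord a; have hc := ltn_ord c.
  have S1 := pspanX a (pspan_s phi s p q).
  have S2 := pspanX c Sx.
  have S3 := pspanX (m - c)%N (pspanX 2 Sh).
  apply: pspan_weaken (pspanM (pspanM (pspanM S1 S2) S3) (Sz k)) _ _; lia.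
have cards : (#|{: 'I_((E + 8 * m) + (6 * m + n)).+1 * 'I_(6 * m + n).+1 * 'I_3}|
    < #|{: M * 'I_m.+1 * 'I_E.+1}|)%N.
  rewrite !card_prod !card_ord.
  have : (19 * m.+1 * E.+1 <= #|M| * m.+1 * E.+1)%N by rewrite !leq_mul.
  apply: leq_trans; rewrite /m.
  have -> : (E + 8 * (3 * n) + (6 * (3 * n) + n)).+1 = (E.+1 + 43 * n)%N by lia.
  have : ((43 * n) * (57 * n + 3) = E)%N by [].
  move: (E) => E' hE {Sv v}; nia.
have [g g0 sg] := linear_dependence cards (fun k => pspan_reduce cubic (Sv k)).
exists g => //; apply: (mulfI (expf_neq0 m (expf_neq0 2 h0))).
rewrite mulr0 -[RHS]sg big_distrr /=; apply: eq_bigr => -[[k c] a] _ /=.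
have -> : (h ^+ 2) ^+ m = (h ^+ 2) ^+ (m - c) * (h ^+ 2) ^+ c.
  by rewrite -exprD subnK // leq_ord.
rewrite /v /= [(x * _) ^+ _]exprMn.
by move: (phi _) (s ^+ _) (x ^+ _) ((h ^+ 2) ^+ c) ((h ^+ 2) ^+ (m - c)) (z k) => *; ring.
Qed.
End BoundedDegree.

(** * Normal forms modulo the sextic, and dominance *)

Section NormalForm.
Variables (K : fieldType) (t : K) (e : nat).
Notation F := (sextic t).
Implicit Types G : {mpoly K[4]}.

Definition weighted_monomial (eps c a : nat) : {mpoly K[4]} :=
  Xu ^+ a * Xv ^+ (e - (a + 2 * c + 3 * eps)) * Xx ^+ c * Xy ^+ eps.

(** Modulo the sextic, y^2 is eliminated: the exponents of y, x and u are kept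
    as index, with that of y less than 2. *)
Definition reduced_weight (x : 'I_2 * 'I_e.+1 * 'I_e.+1) : bool :=
  (x.2 + 2 * x.1.2 + 3 * x.1.1 <= e)%N.
Definition reduced_index : finType := {x | reduced_weight x}.
Definition reduced_monomial (y : reduced_index) : {mpoly K[4]} :=
  weighted_monomial (val y).1.1 (val y).1.2 (val y).2.
Definition reduced_form (g : reduced_index -> K) : {mpoly K[4]} := \sum_y g y *: reduced_monomial y.

Let reducible G := exists g, in_ideal F (G - reduced_form g).

Let reducibleD G H : reducible G -> reducible H -> reducible (G + H).
Proof.
move=> [g [Q eQ]] [h [Q' eQ']]; exists (fun y => g y + h y), (Q + Q').
rewrite mulrDl -eQ -eQ' /reduced_form addrACA -opprD -big_split /=.
by congr (_ - _); apply: eq_bigr => y _; rewrite scalerDl.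
Qed.
Let reducibleZ c G : reducible G -> reducible (c *: G).
Proof.
move=> [g [Q eQ]]; exists (fun y => c * g y), (c *: Q).
rewrite -scalerAl -eQ scalerBr /reduced_form scaler_sumr.
by congr (_ - _); apply: eq_bigr => y _; rewrite scalerA.
Qed.
Let reducible0 : reducible 0.
Proof.
exists (fun=> 0), 0; rewrite mul0r sub0r /reduced_form big1 ?oppr0 // => y _.
by rewrite scale0r.
Qed.
Let reducible_ideal Q G : reducible G -> reducible (G + Q * F).
Proof. by move=> [g [Q' eQ]]; exists g, (Q' + Q); rewrite addrAC eQ mulrDl. Qed.

Let reducible_mono k : forall a b c, (a + b + 2 * c + 3 * k = e)%N ->
  reducible (Xu ^+ a * Xv ^+ b * Xx ^+ c * Xy ^+ k).
Proof.
have [n] := ubnP k; elim: n k => // n ih k kn a b c we.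
have [k2|k2] := ltnP k 2.
  have ha : (a < e.+1)%N by lia.
  have hc : (c < e.+1)%N by lia.
  have ok : reduced_weight (Ordinal k2, Ordinal hc, Ordinal ha) by rewrite /reduced_weight /=; lia.
  pose y0 : reduced_index := Sub _ ok.
  exists (fun y => (y == y0)%:R), 0; rewrite mul0r /reduced_form (bigD1 y0) //= eqxx scale1r.
  rewrite big1 ?addr0 => [|y /negPf ->]; last by rewrite scale0r.
  rewrite /reduced_monomial /= /weighted_monomial /= (_ : (e - _)%N = b) ?subrr //; lia.
have [k' kE] : exists k', k = k'.+2 by exists (k - 2)%N; lia.
pose m : {mpoly K[4]} := Xu ^+ a * Xv ^+ b * Xx ^+ c * Xy ^+ k'.
have -> : Xu ^+ a * Xv ^+ b * Xx ^+ c * Xy ^+ k =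
  Xu ^+ a * Xv ^+ b * Xx ^+ c.+3 * Xy ^+ k'
  + (- 3%:R) *: (Xu ^+ a.+2 * Xv ^+ b.+2 * Xx ^+ c.+1 * Xy ^+ k')
  + (- 1) *: (Xu ^+ (a + 5) * Xv ^+ b.+1 * Xx ^+ c * Xy ^+ k')
  + (- 1) *: (Xu ^+ a.+1 * Xv ^+ (b + 5) * Xx ^+ c * Xy ^+ k')
  + (- (27%:R * t ^+ 2)) *: (Xu ^+ a.+2 * Xv ^+ b.+4 * Xx ^+ c * Xy ^+ k')
  + m * F.
  rewrite /m kE sexticE /sextic_at -!mul_mpolyC !mpolyCN !(mpolyCM, mpolyC_nat).
  rewrite -(addn4 b) -(addn3 c) -(addn2 a) -(addn2 b) -(addn1 a) -(addn1 b) -(addn1 c) -(addn2 k') !exprD.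
  rewrite !mpolyC1.
  by move: (Xu : {mpoly K[4]}) (Xv : {mpoly K[4]}) (Xx : {mpoly K[4]}) (Xy : {mpoly K[4]}) (t%:MP : {mpoly K[4]}) => U V X Y T; ring.
apply: reducible_ideal; repeat apply: reducibleD; try apply: reducibleZ; apply: ih; lia.
Qed.

Lemma normal_form G : G \is e.-homog for (wdeg w1123) ->
  exists g, in_ideal F (G - reduced_form g).
Proof.
move=> /dhomogP hG; rewrite -/(reducible G) [G]mpolyE big_seq.
elim/big_ind: _ => // m mG; apply: reducibleZ.
rewrite mpolyXE_id big_ord4 /= mulr1 !mulrA; apply: reducible_mono.
have := hG m mG; rewrite /= /wdeg big_ord4 /= !(tnth_nth 0%N) /= => <-; lia.
Qed.

Lemma weighted_monomial_homog eps c a : (a + 2 * c + 3 * eps <= e)%N ->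
  weighted_monomial eps c a \is e.-homog for (wdeg w1123).
Proof.
move=> ok.
have hX i k : ('X_i ^+ k : {mpoly K[4]}) \is (tnth w1123 i * k).-homog for (wdeg w1123).
  by apply: dhomogMn; apply: dhomogXU; exact: wdegU.
apply: dhomogM_eq (dhomogM (dhomogM (hX _ _) (hX _ _)) (hX _ _)) (hX _ _) _.
rewrite !(tnth_nth 0%N) /=; lia.
Qed.

Lemma comp_weighted_monomial eps c a :
  weighted_monomial eps c a \mPo coords t = image_monomial t e eps c a.
Proof.
rewrite /weighted_monomial !(rmorphM (@comp_mpoly 4 K 3 (coords t))) !(rmorphXn (@comp_mpoly 4 K 3 (coords t))) /=.
by rewrite !comp_mpolyXU.
Qed.
Lemma comp_reduced_form g : reduced_form g \mPo coords t =
  \sum_(y : reduced_index) g y *: image_monomial t e (val y).1.1 (val y).1.2 (val y).2.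
Proof.
rewrite /reduced_form raddf_sum /=; apply: eq_bigr => y _.
by rewrite comp_mpolyZ comp_weighted_monomial.
Qed.

Lemma comp_ideal G : in_ideal F G -> G \mPo coords t = 0.
Proof.
move=> [Q ->]; rewrite (rmorphM (@comp_mpoly 4 K 3 (coords t))) /=.
by rewrite comp_sextic mulr0.
Qed.
End NormalForm.

Section Degree.
Variable C : fieldType.
Hypothesis char0 : forall n, n.+1%:R != 0 :> C.
Notation K := {fraction {poly C}}.
Let t : K := tofrac 'X.
Notation F := (sextic t).
Notation comp G := (G \mPo coords t).
Implicit Types G H : {mpoly K[4]}.

Lemma reduced_forms_free e (g : 'I_3 * 'I_3 -> reduced_index e -> K) :
  \sum_k comp (reduced_form (g k)) * basis_form K k.1 k.2 = 0 -> forall k y, g k y = 0.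
Proof.
move=> s0 k0 y0.
pose I : finType := ('I_3 * 'I_3 * reduced_index e)%type.
have := @image_monomials_free C char0 I e (fun i => i.1.1) (fun i => i.1.2)
  (fun i => (val i.2).1.1) (fun i => (val i.2).1.2) (fun i => (val i.2).2).
move=> /(_ (fun i => ltn_ord _) (fun i => ltn_ord _) (fun i => ltn_ord _)).
have we (i : I) : ((val i.2).2 + 2 * (val i.2).1.2 + 3 * (val i.2).1.1 <= e)%N := valP i.2.
move=> /(_ we) fr.
apply: (fr _ (fun i => g i.1 i.2) _ (k0, y0)) => [i k r1 r2 r3 r4 r5|].
  case: i k r1 r2 r3 r4 r5 => [[i1 i2] y] [[k1 k2] z] /= /val_inj -> /val_inj -> h1 h2 h3.
  congr (_, _); apply: val_inj; case: y z h1 h2 h3 => [[[e1 c1] a1] p1] [[[e2 c2] a2] p2] /=.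
  by move=> /val_inj -> /val_inj -> /val_inj ->.
rewrite -[RHS]s0 -(pair_big xpredT xpredT (fun k y => g k y *: (image_monomial t e (val y).1.1 (val y).1.2 (val y).2 * basis_form K k.1 k.2))) /=.
apply: eq_bigr => k _; rewrite comp_reduced_form big_distrl /=.
by apply: eq_bigr => y _; rewrite -scalerAl.
Qed.

Let k00 : 'I_3 * 'I_3 := (ord0, ord0).

(** Independence of the nine basis functions over the function field of the
    sextic, with the coefficients written as forms of a common weight. *)
Lemma forms_free e (G : 'I_3 * 'I_3 -> {mpoly K[4]}) :
  (forall k, G k \is e.-homog for (wdeg w1123)) ->
  \sum_k comp (G k) * basis_form K k.1 k.2 = 0 -> forall k, in_ideal F (G k).
Proof.
move=> hG s0.
have /fin_all_exists[g gP] k := @normal_form K t e (G k) (hG k).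
have cG k : comp (G k) = comp (reduced_form (g k)).
  by apply/eqP; rewrite -subr_eq0 -raddfB /= (comp_ideal (gP k)).
have g0 : forall k y, g k y = 0.
  by apply: reduced_forms_free; rewrite -[RHS]s0; apply: eq_bigr => k _; rewrite cG.
move=> k; have := gP k; rewrite /reduced_form big1 ?subr0 // => y _.
by rewrite g0 scale0r.
Qed.

(** Dominance is independence of the single basis form with r = j = 0. *)
Lemma kernel_ideal e G : G \is e.-homog for (wdeg w1123) ->
  comp G = 0 -> in_ideal F G.
Proof.
move=> hG G0.
apply: (@forms_free e (fun k => if k == k00 then G else 0) _ _ k00) => [k|].
  by case: ifP => // _; exact: rpred0.
rewrite big1 // => k _; case: ifP => _; first by rewrite G0 mul0r.
by rewrite raddf0 mul0r.
Qed.

(** Were V to pull back to 0, the reduced form V of weight 1 would too. *)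
Lemma formV_neq0 : formV t != 0.
Proof.
apply/eqP => V0.
have ok : reduced_weight ((ord0, ord0, ord0) : 'I_2 * 'I_2 * 'I_2) by [].
pose y0 : reduced_index 1 := Sub _ ok.
pose g (k : 'I_3 * 'I_3) (y : reduced_index 1) : K := ((k == k00) && (y == y0))%:R.
suff g0 : forall k y, g k y = 0.
  by have /eqP := g0 k00 y0; rewrite /g !eqxx oner_eq0.
have V1 : image_monomial t 1 (val y0).1.1 (val y0).1.2 (val y0).2 = 0.
  rewrite (_ : val y0 = (ord0, ord0, ord0)); last exact: SubK.
  rewrite /image_monomial (_ : (1 - _)%N = 1%N) //.
  have aux (A : comNzRingType) (u v x y : A) a c eps : v = 0 ->
      u ^+ a * v ^+ 1 * x ^+ c * y ^+ eps = 0.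
    by move=> ->; rewrite expr1 mulr0 !mul0r.
  exact: aux.
apply: reduced_forms_free; apply: big1 => k _; rewrite comp_reduced_form big1 ?mul0r // => y _.
rewrite /g; case: (y =P y0) => [->|_]; last by rewrite andbF scale0r.
by rewrite V1 scaler0.
Qed.

Lemma scaleF_pencilV_neq0 :
  scaleF t%:MP 'X_(@Ordinal 3 0 isT) 'X_(@Ordinal 3 1 isT) 'X_(@Ordinal 3 2 isT) != 0
  /\ pencilV 'X_(@Ordinal 3 0 isT) 'X_(@Ordinal 3 1 isT) 'X_(@Ordinal 3 2 isT) != 0 :> {mpoly K[3]}.
Proof.
by have := formV_neq0; rewrite /formV mulf_eq0 negb_or => /andP[].
Qed.

End Degree.

(** * The degree *)

Section AffineCoordinates.
Variables (L : fieldType) (t X Y Z : L).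
Let U := pencilU t X Y Z.
Let V := pencilV X Y Z.
Let S := scaleF t X Y Z.
Hypotheses (X0 : X != 0) (V0 : V != 0) (S0 : S != 0).
Let s := U / V.
Let p := Y / X.
Let q := Z / X.

(** A point (X : Y : Z) lies on the cubic of the pencil with u : v = U : V. *)
Lemma affine_cubic : q ^+ 3 = s * p ^+ 3 - s * q + p + 2%:R * t.
Proof.
have h : s * (p ^+ 3 - q) = q ^+ 3 - p - 2%:R * t.
  have -> : p ^+ 3 - q = V / X ^+ 3.
    by rewrite /p /q /V /pencilV; field.
  rewrite /s mulrA divfK // /U /pencilU /p /q; by field.
have -> : s * p ^+ 3 - s * q + p + 2%:R * t = s * (p ^+ 3 - q) + p + 2%:R * t by ring.
by rewrite h; ring.
Qed.

Let homU : U = V * s. Proof. by rewrite /s mulrC divfK. Qed.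
Let homY : Y = X * p. Proof. by rewrite /p mulrC divfK. Qed.
Let homZ : Z = X * q. Proof. by rewrite /q mulrC divfK. Qed.

Let flexE : flexform U V X Y Z = V ^+ 3 * X ^+ 5 * flexform s 1 1 p q.
Proof. by rewrite -flexform_scale !mulr1 -homU -homY -homZ. Qed.
Let triE : triplex U V X Y Z = V ^+ 8 * X ^+ 12 * triplex s 1 1 p q.
Proof. by rewrite -triplex_scale !mulr1 -homU -homY -homZ. Qed.

Lemma affine_flex_neq0 : flexform s 1 1 p q != 0.
Proof.
apply: contraNneq S0 => h; rewrite /S /scaleF -/U -/V flexE h.
by rewrite !mulr0.
Qed.

Lemma affine_x : 9%:R != 0 :> L ->
  formx t X Y Z / (S * V) ^+ 2 * flexform s 1 1 p q ^+ 2
  = 9%:R^-1 * triplex s 1 1 p q.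
Proof.
move=> n9; have := affine_flex_neq0; have := S0; rewrite /S /scaleF /formx -/U -/V flexE triE.
move: (flexform s 1 1 p q) (triplex s 1 1 p q) => h th S0' h0.
have n6 : 6%:R != 0 :> L.
  by apply: contraNneq S0' => ->; rewrite !mul0r.
have n36 : 4%:R * 9%:R = 6%:R ^+ 2 :> L by ring.
apply: (mulfI n9); rewrite [RHS]mulrA divff // mul1r.
apply: (mulfI (expf_neq0 2 n6)).
rewrite -[in RHS]n36; field.
by rewrite V0 X0 n6 h0.
Qed.
End AffineCoordinates.

Section FormsSpan.
Variables (K : fieldType) (L : fieldType) (T : {rmorphism {mpoly K[3]} -> L}).
Notation X := ('X_(@Ordinal 3 0 isT) : {mpoly K[3]}).
Notation Y := ('X_(@Ordinal 3 1 isT) : {mpoly K[3]}).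
Notation Z := ('X_(@Ordinal 3 2 isT) : {mpoly K[3]}).
Let phi : {rmorphism K -> L} := T \o (@mpolyC 3 K).
Hypothesis X0 : T X != 0.

Lemma form_pspan (s : L) d P : P \is d.-homog ->
  pspan phi s (T Y / T X) (T Z / T X) 0%N d (T P / T X ^+ d).
Proof.
move=> /dhomogP hP; rewrite [P]mpolyE (raddf_sum T) big_distrl /= big_seq.
apply: pspan_sum => m mP; have := hP m mP; rewrite /= mdegE => dm.
have -> : T (P@_m *: 'X_[m]) / T X ^+ d =
   phi P@_m * (s ^+ 0 * (T Y / T X) ^+ m (@Ordinal 3 1 isT) * (T Z / T X) ^+ m (@Ordinal 3 2 isT)).
  rewrite -mul_mpolyC (rmorphM T) mpolyXE_id (rmorph_prod T) /=.
  move: dm; rewrite !big_ord3 /=.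
  rewrite !(rmorphXn T) => <-; rewrite addn0 mulr1 expr0 mul1r !expr_div_n !exprD.
  move: (m _) (m _) (m _) => i j k; rewrite -!mulrA; congr (_ * _).
  move: (T X) (T Y) (T Z) X0 => x y z x0.
  have xi := expf_neq0 i x0; have xj := expf_neq0 j x0; have xk := expf_neq0 k x0.
  move: (x ^+ i) (x ^+ j) (x ^+ k) (y ^+ j) (z ^+ k) xi xj xk => xi xj xk yj zk h1 h2 h3.
  by field; rewrite h1 h2 h3.
apply: pspan_mono => //; move: dm; rewrite !big_ord3 /=; lia.
Qed.
End FormsSpan.

Lemma weighted_quotient (L : fieldType) (U V x y : L) e eps c a : V != 0 ->
  (a + 2 * c + 3 * eps <= e)%N ->
  U ^+ a * V ^+ (e - (a + 2 * c + 3 * eps)) * x ^+ c * y ^+ eps =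
  V ^+ e * ((U / V) ^+ a * (x / V ^+ 2) ^+ c * (y / V ^+ 3) ^+ eps).
Proof.
move=> V0 we; rewrite -{2}(subnK we); move: (e - _)%N => b.
rewrite !expr_div_n -!exprM !exprD.
by rewrite !expr0; field; rewrite !expf_neq0.
Qed.

Lemma basis_form_homog (K : fieldType) (k : 'I_3 * 'I_3) : basis_form K k.1 k.2 \is 6.-homog.
Proof.
have hX i n : ('X_i ^+ n : {mpoly K[3]}) \is n.-homog.
  by rewrite -[X in X.-homog]mul1n; apply: dhomogMn; apply: dhomogXU; exact: mdeg1.
apply: dhomogM_eq (dhomogM (hX _ _) (hX _ _)) (hX _ _) _.
by have := ltn_ord k.1; have := ltn_ord k.2; lia.
Qed.

Lemma weight_bound m E (i : 'I_2) (c : 'I_m.+1) (a : 'I_E.+1) :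
  (a + 2 * c + 3 * i <= E + 2 * m + 3)%N.
Proof. by have := ltn_ord i; have := ltn_ord c; have := ltn_ord a; lia. Qed.

(** Pulled back to the plane, s = u/v, [xx] = x/v^2 and [yy] = y/v^3 generate the
    function field of the sextic.  The 20 functions b and [yy] b, with b one of
    the nine basis functions or a given h, are dependent over K(s, [xx]), which
    is a relation between h and the basis functions over K(s, [xx], [yy]). *)
Section Spanning.
Variables (K L : fieldType) (t : K) (T : {rmorphism {mpoly K[3]} -> L}).
Hypothesis T_eq0 : forall P, (T P == 0) = (P == 0).
Hypothesis nine : 9%:R != 0 :> K.
Notation X := ('X_(@Ordinal 3 0 isT) : {mpoly K[3]}).
Notation Y := ('X_(@Ordinal 3 1 isT) : {mpoly K[3]}).
Notation Z := ('X_(@Ordinal 3 2 isT) : {mpoly K[3]}).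
Hypothesis S0 : scaleF t%:MP X Y Z != 0.
Hypothesis V0 : pencilV X Y Z != 0.
Let phi : {rmorphism K -> L} := T \o (@mpolyC 3 K).

Let X0 : T X != 0. Proof. by rewrite T_eq0 mpoly_X_neq0. Qed.
Let tau : L := phi t.
Let p := T Y / T X.
Let q := T Z / T X.
Let s := pencilU tau (T X) (T Y) (T Z) / pencilV (T X) (T Y) (T Z).
Let S := scaleF tau (T X) (T Y) (T Z).
Let V := pencilV (T X) (T Y) (T Z).
Let xx := formx tau (T X) (T Y) (T Z) / (S * V) ^+ 2.
Let yy := formy tau (T X) (T Y) (T Z) / (S * V) ^+ 3.

Let TS0 : S != 0. Proof. by rewrite -[S](rmorph_scaleF T) T_eq0. Qed.
Let TV0 : V != 0. Proof. by rewrite -[V](rmorph_pencilV T) T_eq0. Qed.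

Let cubic : q ^+ 3 = s * p ^+ 3 - s * q + p + phi (2%:R * t).
Proof. by rewrite (rmorphM phi) (rmorph_nat phi); exact: affine_cubic. Qed.

Let flex0 : flexform s 1 1 p q != 0.
Proof. exact: (affine_flex_neq0 X0 TV0 TS0). Qed.

Let Sxx : pspan phi s p q 8%N 6%N (xx * flexform s 1 1 p q ^+ 2).
Proof.
have n9 : 9%:R != 0 :> L by rewrite -(rmorph_nat phi) fmorph_eq0 nine.
have -> : xx * flexform s 1 1 p q ^+ 2 = phi 9%:R^-1 * triplex s 1 1 p q.
  by rewrite (fmorphV phi) (rmorph_nat phi); exact: affine_x.
have [_ Sx] := covariants_pspan cubic.
exact: (pspanM (pspanC _ _ _ _ _) Sx).
Qed.

Let TformV : T (formV t) = S * V.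
Proof. by rewrite /formV (rmorphM T) (rmorph_scaleF T) (rmorph_pencilV T). Qed.

Let TformU : T (formU t) = S * pencilU tau (T X) (T Y) (T Z).
Proof. by rewrite /formU (rmorphM T) (rmorph_scaleF T) (rmorph_pencilU T). Qed.

Let Tprod (a b c d : {mpoly K[3]}) i j k l :
  T (a ^+ i * b ^+ j * c ^+ k * d ^+ l) = T a ^+ i * T b ^+ j * T c ^+ k * T d ^+ l.
Proof. by rewrite !(rmorphM T) !(rmorphXn T). Qed.

Let image_monomialE e eps c a : (a + 2 * c + 3 * eps <= e)%N ->
  T (image_monomial t e eps c a) = T (formV t) ^+ e * (s ^+ a * xx ^+ c * yy ^+ eps).
Proof.
move=> we; rewrite TformV /image_monomial Tprod TformV TformU.
rewrite (rmorph_formx T) (rmorph_formy T).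
rewrite (weighted_quotient _ _ _ (mulf_neq0 TS0 TV0) we).
have eU : S * pencilU tau (T X) (T Y) (T Z) / (S * V) = s.
  by rewrite -mulf_div divff // mul1r.
by rewrite eU.
Qed.

Definition spanning_set (h : L) (o : option ('I_3 * 'I_3)) : L :=
  if o is Some k then T (basis_form K k.1 k.2) / T X ^+ 6 else h.

Lemma spanning_relation d (P Q : {mpoly K[3]}) :
  P \is d.-homog -> Q \is d.-homog -> Q != 0 ->
  exists m E e,
    exists2 g : option ('I_3 * 'I_3) * ('I_2 * 'I_m.+1 * 'I_E.+1) -> K,
    (forall x : 'I_2 * 'I_m.+1 * 'I_E.+1, (x.2 + 2 * x.1.2 + 3 * x.1.1 <= e)%N) /\ (exists x, g x != 0) &
    \sum_x phi (g x) * T (image_monomial t e x.2.1.1 x.2.1.2 x.2.2)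
      * spanning_set (T P / T Q) x.1 = 0.
Proof.
move=> hP hQ Q0; have TQ0 : T Q != 0 by rewrite T_eq0.
pose M : finType := (option ('I_3 * 'I_3) * 'I_2)%type.
(* a common denominator, of degree d in h and of degree 54, that of formy, in y *)
pose Den := (T Q / T X ^+ d) * (T (formV t) ^+ 3 / T X ^+ 54).
pose z (k : M) := yy ^+ k.2 * spanning_set (T P / T Q) k.1 * Den.
have Den0 : Den != 0.
  by rewrite !mulf_neq0 ?invr_eq0 ?expf_neq0 // TformV mulf_neq0.
have Sz k : pspan phi s p q 0%N (d + 60) (z k).
  have SB : pspan phi s p q 0%N (d + 6) (spanning_set (T P / T Q) k.1 * (T Q / T X ^+ d)).
    case: k => -[k|] i /=; last first.
      rewrite mulrA divfK //; apply: pspan_weaken (form_pspan X0 s hP) _ _ => //; exact: leq_addr.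
    rewrite addnC; exact: (pspanM (form_pspan X0 s (basis_form_homog K k)) (form_pspan X0 s hQ)).
  have SY : pspan phi s p q 0%N 54%N (yy ^+ k.2 * (T (formV t) ^+ 3 / T X ^+ 54)).
    case: k {SB} => o [[|[|//]] ? /=].
      rewrite expr0 mul1r -(rmorphXn T); apply: (form_pspan X0 s).
      by apply: (@dhomogMn _ _ _ 18 _ 3); case: (formUV_homog t).
    rewrite expr1 /yy -TformV mulrA divfK; last by rewrite expf_neq0 // TformV mulf_neq0.
    rewrite -[tau]/(T t%:MP) -(rmorph_formy T).
    exact: (form_pspan X0 s (coords_homog t (@Ordinal 4 3 isT))).
  have -> : z k = spanning_set (T P / T Q) k.1 * (T Q / T X ^+ d)
      * (yy ^+ k.2 * (T (formV t) ^+ 3 / T X ^+ 54)).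
    by rewrite /z /Den [yy ^+ _ * _]mulrC mulrACA.
  have d60 : (d + 6 + 54 <= d + 60)%N by rewrite -addnA.
  exact: (pspan_weaken (pspanM SB SY) (leqnn 0%N) d60).
have M20 : (18 < #|M|)%N by rewrite card_prod card_option card_prod !card_ord.
have [m [E [g g0 sg]]] := bounded_degree cubic flex0 (proj1 (covariants_pspan cubic)) Sxx Sz M20.
exists m, E, (E + 2 * m + 3)%N, (fun x => g (x.1, x.2.1.1, x.2.1.2, x.2.2)).
  split=> [[[i c] a]|]; first exact: weight_bound.
  by case: g0 => [[[[o i] c] a] g0]; exists (o, (i, c, a)).
pose N := T (formV t) ^+ (E + 2 * m + 3) / Den.
have := congr1 (fun w => N * w) sg; rewrite mulr0 big_distrr /= => N0; rewrite -[RHS]N0 {N0}.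
pose f (y : M * 'I_m.+1 * 'I_E.+1) := (y.1.1.1, (y.1.1.2, y.1.2, y.2)).
rewrite (reindex f) /=; last first.
  exists (fun x => (x.1, x.2.1.1, x.2.1.2, x.2.2)).
    by case=> [[[o i] c] a].
  by case=> o [[i c] a].
apply: eq_bigr => -[[[o i] c] a] _ /=.
rewrite (image_monomialE (weight_bound i c a)).
rewrite /N /z /=; move: (T (formV t) ^+ _) (T (g _)%:MP) (s ^+ _) (xx ^+ _) (yy ^+ _).
move: (spanning_set _ _) (Den) Den0 => B D D0 f1 f2 f3 f4 f5.
by field.
Qed.
End Spanning.

Section TriplingMap.
Variable C : fieldType.
Hypothesis char0 : forall n, n.+1%:R != 0 :> C.
Notation K := {fraction {poly C}}.
Let t : K := tofrac 'X.
Notation F := (sextic t).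
Notation comp G := (G \mPo coords t).
Notation X := ('X_(@Ordinal 3 0 isT) : {mpoly K[3]}).
Notation Y := ('X_(@Ordinal 3 1 isT) : {mpoly K[3]}).
Notation Z := ('X_(@Ordinal 3 2 isT) : {mpoly K[3]}).

Lemma coords_neq0 : exists i, tnth (coords t) i != 0.
Proof. by exists (@Ordinal 4 1 isT); exact: (formV_neq0 char0). Qed.

Definition tripling : @ratmap K 2 4 w1123 F :=
  @RatMap K 2 4 w1123 F 18 (coords t) (coords_homog t) coords_neq0 (comp_sextic t).

Lemma tripling_dominant : dominant tripling.
Proof. by move=> e G hG; exact: (kernel_ideal char0 hG). Qed.

Let L : fieldType := {fraction {mpoly K[3]}}.
Let T : {rmorphism {mpoly K[3]} -> L} := @FracField.tofrac {mpoly K[3]}.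
Let T_eq0 P : (T P == 0) = (P == 0). Proof. exact: (@tofrac_eq0 _ P). Qed.
Let T_inj : injective T.
Proof. by move=> P Q /eqP; rewrite tofrac_eq => /eqP. Qed.
Let phi : {rmorphism K -> L} := T \o (@mpolyC 3 K).
Let TZ c P : T (c *: P) = phi c * T P.
Proof. by rewrite -mul_mpolyC rmorphM. Qed.

Let X0 : T X != 0. Proof. by rewrite T_eq0 mpoly_X_neq0. Qed.

Definition basis (k : 'I_3 * 'I_3) : L := T (basis_form K k.1 k.2) / T X ^+ 6.

Let X_homog d : X ^+ d \is d.-homog.
Proof. by rewrite -[X in X.-homog]mul1n; apply: dhomogMn; apply: dhomogXU; exact: mdeg1. Qed.

Lemma basis_funfield k : funfield_proj (basis k).
Proof.
exists 6%N, (basis_form K k.1 k.2), (X ^+ 6); split.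
- exact: basis_form_homog.
- exact: X_homog.
- exact: (expf_neq0 6 (mpoly_X_neq0 _ _)).
- by rewrite /basis -(rmorphXn T 6 X).
Qed.

Lemma comp_neq0 e (H : {mpoly K[4]}) : H \is e.-homog for (wdeg w1123) -> ~ in_ideal F H -> T (comp H) != 0.
Proof. by move=> hH nH; rewrite T_eq0; apply/eqP => /(kernel_ideal char0 hH). Qed.

(** Relations between the basis functions are relations between forms. *)
Lemma basis_relation (A : 'I_3 * 'I_3 -> {mpoly K[3]}) :
  \sum_k T (A k) * basis k = 0 -> \sum_k A k * basis_form K k.1 k.2 = 0.
Proof.
have X6 : T X ^+ 6 != 0 := expf_neq0 6 X0.
move=> s0; apply: T_inj; rewrite rmorph0 (raddf_sum T).
apply: (mulIf (invr_neq0 X6)); rewrite mul0r big_distrl /= -[RHS]s0.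
by apply: eq_bigr => k _; rewrite (rmorphM T) -mulrA.
Qed.

(** Clear the denominators of the coefficients and apply the independence of
    the basis forms. *)
Lemma basis_free (c : 'I_3 * 'I_3 -> L) :
  (forall k, funfield_pullback tripling (c k)) ->
  \sum_k c k * basis k = 0 -> forall k, c k = 0.
Proof.
move=> /fin_all_exists[e /fin_all_exists[G /fin_all_exists[H GH]]] s0.
have hG k : G k \is (e k).-homog for (wdeg w1123) by case: (GH k).
have hH k : H k \is (e k).-homog for (wdeg w1123) by case: (GH k).
have [g gE] : exists g : {rmorphism {mpoly K[4]} -> L}, forall P, T (comp P) = g P.
  by exists (T \o comp_mpoly (coords t)).
have H0 k : g (H k) != 0.
  by rewrite -gE; case: (GH k) => _ hH' nH _; exact: comp_neq0 hH' nH.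
have cE k : c k = g (G k) / g (H k) by rewrite -!gE; case: (GH k).
pose N := \prod_k g (H k).
pose G' k := G k * \prod_(k' | k' != k) H k'.
have G'E k : g (G' k) = c k * N.
  by rewrite (cE k); exact: (@clear_denominators _ _ g _ G H k (H0 k)).
have hG' k : G' k \is (\sum_k e k)%N.-homog for (wdeg w1123).
  rewrite (bigD1 k) //=; apply: dhomogM => //.
  by elim/big_rec2: _ => [|i d P _ hP]; [exact: dhomog1 | exact: dhomogM].
have s1 : \sum_k comp (G' k) * basis_form K k.1 k.2 = 0.
  apply: basis_relation; under eq_bigr => k _ do rewrite gE G'E mulrAC.
  by rewrite -big_distrl /= s0 mul0r.
move=> k; have := comp_ideal (forms_free char0 hG' s1 k) => z.
have := G'E k; rewrite -gE z rmorph0 => /esym/eqP; rewrite mulf_eq0 => /orP[/eqP //|].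
by rewrite prodf_seq_eq0 => /hasP[k' _]; rewrite (negPf (H0 k')).
Qed.

(** In the relation between h and the basis functions, the coefficient of h is
    not 0, for otherwise the basis functions, or the reduced monomials
    themselves, would be dependent. *)
Lemma basis_span h : funfield_proj h ->
  exists c : 'I_3 * 'I_3 -> L,
    (forall k, funfield_pullback tripling (c k)) /\ h = \sum_k c k * basis k.
Proof.
move=> [d [P [Q [hP hQ Q0 hE]]]].
have nine : 9%:R != 0 :> K := rational_function_natr_neq0 char0 8.
have [S0 V0] := scaleF_pencilV_neq0 char0.
have [m [E [e [g [we g0] sg]]]] := spanning_relation T_eq0 nine S0 V0 hP hQ Q0.
pose J : finType := ('I_2 * 'I_m.+1 * 'I_E.+1)%type.
pose G o := \sum_(x : J) g (o, x) *: weighted_monomial K e x.1.1 x.1.2 x.2.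
have hG o : G o \is e.-homog for (wdeg w1123).
  by apply: rpred_sum => x _; apply: dhomogZ; apply: weighted_monomial_homog.
have cG o : comp (G o) = \sum_(x : J) g (o, x) *: image_monomial t e x.1.1 x.1.2 x.2.
  rewrite /G (raddf_sum (@comp_mpoly 4 K 3 (coords t))) /=; apply: eq_bigr => x _.
  by rewrite comp_mpolyZ comp_weighted_monomial.
have TG o : T (comp (G o)) = \sum_(x : J) phi (g (o, x)) * T (image_monomial t e x.1.1 x.1.2 x.2).
  by rewrite cG (raddf_sum T); apply: eq_bigr => x _; exact: TZ.
have rel : \sum_o T (comp (G o)) * spanning_set T h o = 0.
  rewrite -[RHS]sg -hE; under eq_bigr => o _ do rewrite TG big_distrl /=.
  by rewrite pair_bigA /=; apply: eq_bigr => -[o x] _.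
rewrite big_option /= in rel.
have GN0 : T (comp (G None)) != 0.
  apply/eqP => GN.
  have aux (A : nzRingType) (a b c : A) : a = 0 -> a * b + c = 0 -> c = 0.
    by move=> ->; rewrite mul0r add0r.
  have {}rel := basis_relation (aux _ _ _ _ GN rel).
  case: g0 => -[o x]; case/eqP; case: o => [k|].
    pose I : finType := ('I_3 * 'I_3 * J)%type.
    apply: (@image_monomials_free C char0 I e (fun i => i.1.1) (fun i => i.1.2)
      (fun i => i.2.1.1) (fun i => i.2.1.2) (fun i => i.2.2) _ _ _ _ _
      (fun i => g (Some i.1, i.2)) _ (k, x)) => //.
      by case=> [[i1 i2] [[i3 i4] i5]] [[k1 k2] [[k3 k4] k5]] /=; do 5!move/val_inj => ->.
    rewrite -[RHS]rel -(pair_big xpredT xpredT (fun k x => g (Some k, x) *: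
      (image_monomial t e x.1.1 x.1.2 x.2 * basis_form K k.1 k.2))) /=.
    apply: eq_bigr => k' _; rewrite cG big_distrl /=.
    by apply: eq_bigr => x' _; rewrite -scalerAl.
  apply: (@image_monomials_free C char0 J e (fun=> 0%N) (fun=> 0%N)
      (fun i => i.1.1) (fun i => i.1.2) (fun i => i.2) _ _ _ _ _
      (fun i => g (None, i)) _ x) => //.
    by case=> [[i3 i4] i5] [[k3 k4] k5] /= _ _; do 3!move/val_inj => ->.
  have : comp (G None) = 0 by apply: T_inj; rewrite GN rmorph0.
  rewrite cG => /(congr1 (fun z => z * basis_form K 0 0)); rewrite mul0r big_distrl /= => e0.
  by rewrite -[RHS]e0; apply: eq_bigr => x' _; rewrite -scalerAl.
exists (fun k => - T (comp (G (Some k))) / T (comp (G None))); split.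
  move=> k; exists e, (- G (Some k)), (G None); split.
  - by rewrite rpredN; exact: hG.
  - exact: hG.
  - by move=> /comp_ideal z; case/eqP: GN0; rewrite z rmorph0.
  - have compN := rmorphN (T \o comp_mpoly (coords t)) (G (Some k)).
    exact: (congr1 (fun z => z / T (comp (G None))) (esym compN)).
exact: (solve_relation GN0 rel).
Qed.

Lemma tripling_degree : ratmap_degree tripling 9.
Proof.
apply: (@ext_degree_fin _ _ _ ('I_3 * 'I_3)%type 9 basis).
- by rewrite card_prod !card_ord.
- exact: basis_funfield.
- exact: basis_span.
- exact: basis_free.
Qed.

Lemma dominant_map_of_degree_nine :
  exists f : @ratmap K 2 4 w1123 F, dominant f /\ ratmap_degree f 9.
Proof.
exists tripling; split; [exact: tripling_dominant | exact: tripling_degree].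
Qed.
End TriplingMap.

(** Fractions of C[t] are formed from the field structure of C on one side and
    from its ring structure on the other; the two results are convertible, but
    large.  Rewriting along an equation of fields compares them only once. *)
Lemma dominant_map_transport (C : fieldType)
    (char0 : forall n, n.+1%:R != 0 :> C) (K : fieldType)
    (e : ({fraction {poly C}} : fieldType) = K) :
  let t := ecast L (L : fieldType) e (tofrac 'X) in
  exists f : @ratmap K 2 4 w1123 (sextic t), dominant f /\ ratmap_degree f 9.
Proof. by case: K / e; exact: dominant_map_of_degree_nine. Qed.

Lemma Ct_eq (R : realType) :
  ({fraction {poly (R[i] : fieldType)}} : fieldType) = Ct R.
Proof. by []. Defined.

(** * The theorem *)

Theorem theorem1p6 (R : realType) :
  [/\ S_t R \is 6.-homog for (wdeg w1123),
      geom_integral (S_t R),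
      smooth_whypersurface w1123 (S_t R) &
      exists f : @ratmap (Ct R) 2 4 w1123 (S_t R),
        dominant f /\ ratmap_degree f 9].
Proof.
split.
- exact: sextic_homog.
- exact: S_t_geom_integral.
- exact: S_t_smooth.
- rewrite S_tE; have := dominant_map_transport (@complex_natr_neq0 R) (Ct_eq R).
  by have <- : ecast L (L : fieldType) (Ct_eq R) (tofrac 'X) = Ct_var R by [].
Qed.
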